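(* Let $f=b+f_1+f_2+f_{12}$ be a fixed function on $[0,1]^2$ belonging to $\mathcal{F}_m$ for all sufficiently large even $m$. For each even $m$, with $n=m^2$, let $y_{k\ell}=f(k/m,\ell/m)+\varepsilon_{k\ell}$, $k,\ell=1,\dots,m$, with $\varepsilon_{k\ell}$ independent $N(0,\sigma^2)$. Let $\lambda=\lambda_n>0$ and let $(\hat\theta_1,\hat\theta_2,\hat\theta_{12},\hat f)$, $\hat f=\hat b+\hat f_1+\hat f_2+\hat f_{12}$, minimize, over $\theta_1,\theta_2,\theta_{12}\ge0$ and $g=b'+g_1+g_2+g_{12}\in\mathcal{F}_m$, the COSSO objective $$\frac1n\sum_{k=1}^m\sum_{\ell=1}^m\{y_{k\ell}-g(k/m,\ell/m)\}^2+\theta_1^{-1}\int_0^1\{g_1''(s)\}^2ds+\theta_2^{-1}\int_0^1\{g_2''(t)\}^2dt+\theta_{12}^{-1}\int_0^1\!\!\int_0^1\Big\{\frac{\partial^4g_{12}(s,t)}{\partial s^2\partial t^2}\Big\}^2ds\,dt+\lambda(\theta_1+\theta_2+\theta_{12}).$$ If $\lambda_n\to0$ and $n\lambda_n\to\infty$ as $n\to\infty$, then the COSSO selects the correct model with probability tending to $1$: the probability that, for every $\alpha\in\{1,2,12\}$, $\hat f_\alpha=0$ if and only if $f_\alpha=0$, tends to $1$ as $n\to\infty$.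
   Context: Basis functions on $[0,1]$ for even $m$: $\gamma_1(t)=1$; $\gamma_{2\nu}(t)=\sqrt2\cos(2\pi\nu t)$ and $\gamma_{2\nu+1}(t)=\sqrt2\sin(2\pi\nu t)$ for $\nu=1,\dots,m/2-1$; $\gamma_m(t)=\cos(\pi mt)$. $\bar T_m=\mathrm{span}\{\gamma_2,\dots,\gamma_m\}$, $T_m=\{1\}\oplus\bar T_m$, and $$\mathcal{F}_m=T_m\otimes T_m=\{1\}\oplus\bar T_m^1\oplus\bar T_m^2\oplus(\bar T_m^1\otimes\bar T_m^2),$$ i.e. all functions $\sum_{\mu,\nu=1}^m a_{\mu\nu}\gamma_\mu(s)\gamma_\nu(t)$. The components of such a function are the constant $a_{11}$, the main effects $\sum_{\mu\ge2}a_{\mu1}\gamma_\mu(s)$ (subscript $1$) and $\sum_{\nu\ge2}a_{1\nu}\gamma_\nu(t)$ (subscript $2$), and the interaction $\sum_{\mu,\nu\ge2}a_{\mu\nu}\gamma_\mu(s)\gamma_\nu(t)$ (subscript $12$). $\lambda_n$ is a deterministic sequence. Convention: if $\theta_\alpha=0$ then the component with subscript $\alpha$ must be $0$ and the corresponding penalty term is $0$ ($0/0=0$). *)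

(* Defs.v *)
(* MathComp-Analysis, over an arbitrary realType. *)
From HB Require Import structures.
From mathcomp Require Import all_boot all_order all_algebra.
From mathcomp Require Import all_classical all_reals all_analysis.

Set Implicit Arguments.
Unset Strict Implicit.
Unset Printing Implicit Defensive.
Import Order.TTheory GRing.Theory Num.Theory.
Import numFieldNormedType.Exports.
Local Open Scope classical_set_scope.
Local Open Scope ring_scope.

Section basis.
Context {R : realType}.

(* Meaningful for m even and 1 <= nu <= m. Being even, nu = m has to be tested
   before the parity; it is normalized on the grid k/m, hence has no factor
   Num.sqrt 2. *)
Definition gamma (m nu : nat) (t : R) : R :=
  if nu == 1%N then 1
  else if nu == m then cos (pi * m%:R * t)
  else if odd nu then Num.sqrt 2 * sin (2 * pi * nu./2%:R * t)
  else Num.sqrt 2 * cos (2 * pi * nu./2%:R * t).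

(* Functions on [0, 1] are given by their trigonometric formula on the whole
   line; only their values on [0, 1] are used. *)
Definition Tbar (m : nat) : set (R -> R) :=
  [set h | exists c : nat -> R,
     h = fun t => \sum_(2 <= nu < m.+1) c nu * gamma m nu t].

Definition Tbar_tensor (m : nat) : set (R -> R -> R) :=
  [set h | exists c : nat -> nat -> R,
     h = fun s t => \sum_(2 <= mu < m.+1) \sum_(2 <= nu < m.+1)
           c mu nu * gamma m mu s * gamma m nu t].

End basis.

(* A function b + g_1(s) + g_2(t) + g_12(s, t), kept with its decomposition;
   the decomposition is unique for elements of F_m. *)
Record anova (R : realType) := Anova {
  anova_const : R;
  anova_main1 : R -> R;
  anova_main2 : R -> R;
  anova_inter : R -> R -> R }.

Record thetas (R : realType) := Thetas {
  theta1 : R;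
  theta2 : R;
  theta12 : R }.

Section cosso.
Context {R : realType}.
Local Notation mu := (@lebesgue_measure R).

Definition anova_eval (g : anova R) (s t : R) : R :=
  anova_const g + anova_main1 g s + anova_main2 g t + anova_inter g s t.

Definition Fspace (m : nat) : set (anova R) :=
  [set g | [/\ Tbar m (anova_main1 g), Tbar m (anova_main2 g) &
               Tbar_tensor m (anova_inter g)]].

Definition zero1 (h : R -> R) : Prop :=
  forall t, 0 <= t <= 1 -> h t = 0.

Definition zero2 (h : R -> R -> R) : Prop :=
  forall s t, 0 <= s <= 1 -> 0 <= t <= 1 -> h s t = 0.

Definition penalty1 (h : R -> R) : R :=
  \int[mu]_(t in `[0, 1]) (h^`(2)%classic t) ^+ 2.

Definition penalty2 (h : R -> R -> R) : R :=
  \int[mu]_(s in `[0, 1]) \int[mu]_(t in `[0, 1])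
    ((fun s' => (h s')^`(2)%classic t)^`(2)%classic s) ^+ 2.

(* The data point of index (k, l), k, l < m, sits at ((k+1)/m, (l+1)/m). *)
Definition grid (m : nat) (k : 'I_m) : R := k.+1%:R / m%:R.

(* Since 0^-1 = 0, the penalty of a component with theta = 0 is 0; that such a
   component must vanish is part of [cosso_admissible]. *)
Definition cosso_objective (m : nat) (y : 'I_m -> 'I_m -> R) (lambda : R)
    (th : thetas R) (g : anova R) : R :=
  (m ^ 2)%:R^-1 *
    (\sum_(k < m) \sum_(l < m) (y k l - anova_eval g (grid k) (grid l)) ^+ 2)
  + (theta1 th)^-1 * penalty1 (anova_main1 g)
  + (theta2 th)^-1 * penalty1 (anova_main2 g)
  + (theta12 th)^-1 * penalty2 (anova_inter g)
  + lambda * (theta1 th + theta2 th + theta12 th).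

Definition cosso_admissible (m : nat) (th : thetas R) (g : anova R) : Prop :=
  [/\ [/\ 0 <= theta1 th, 0 <= theta2 th & 0 <= theta12 th],
      Fspace m g &
      [/\ theta1 th = 0 -> zero1 (anova_main1 g),
          theta2 th = 0 -> zero1 (anova_main2 g) &
          theta12 th = 0 -> zero2 (anova_inter g)]].

Definition cosso_minimizer (m : nat) (y : 'I_m -> 'I_m -> R) (lambda : R)
    (th : thetas R) (g : anova R) : Prop :=
  cosso_admissible m th g /\
  forall th' g', cosso_admissible m th' g' ->
    cosso_objective y lambda th g <= cosso_objective y lambda th' g'.

Definition same_model (g f : anova R) : Prop :=
  [/\ zero1 (anova_main1 g) <-> zero1 (anova_main1 f),
      zero1 (anova_main2 g) <-> zero1 (anova_main2 f) &
      zero2 (anova_inter g) <-> zero2 (anova_inter f)].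

End cosso.

Section probability.
Context (d : measure_display) (T : measurableType d) (R : realType).
Variable P : probability T R.

Definition mutually_independent (I : finType) (X : I -> {RV P >-> R}) : Prop :=
  forall (J : {set I}) (A : I -> set R), (forall i, measurable (A i)) ->
    P (\bigcap_(i in [set` J]) X i @^-1` A i)
    = (\prod_(i in J) P (X i @^-1` A i))%E.

(* The parameter of normal_prob is the standard deviation: X ~ N(0, sigma^2).
   Only meaningful for sigma != 0. *)
Definition centered_normal (sigma : R) (X : {RV P >-> R}) : Prop :=
  forall A : set R, measurable A ->
    distribution P X A = normal_prob 0 sigma A.

End probability.

(* Main.v *)
Require Import Defs.
From mathcomp Require Import all_boot all_order all_algebra.
From mathcomp Require Import all_classical all_reals all_analysis.
From mathcomp Require Import measurable_realfun.
From mathcomp Require Import ring lra.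
Import Order.TTheory GRing.Theory Num.Theory.
Import numFieldNormedType.Exports.

Set Implicit Arguments.
Unset Strict Implicit.
Unset Printing Implicit Defensive.
Local Open Scope classical_set_scope.
Local Open Scope ring_scope.

(** The idea is to pass to the coefficients in the basis gamma, where the COSSO
    splits into one explicit problem per component.

    The functions gamma_mu(s) gamma_nu(t) are orthonormal for the average over
    the grid ([tensor_orthonormal]), so the residual sum of squares is, up to a
    constant, the sum of (z_p - a_p)^2, where a_p is a coefficient of the
    candidate and z_p the empirical coefficient of the data
    ([residual_mean]). On [0, 1] the same functions are orthogonal and are
    eigenfunctions of the second derivative, so the roughness penalties are
    weighted sums of squares w_p a_p^2 with w_p > 0 ([penalty1E],
    [penalty2E]). Hence the objective is a constant, plus one square for the
    constant term, plus, for each of the three components,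
      sum (z_p - a_p)^2 + theta^-1 sum w_p a_p^2 + lambda theta
    ([cosso_objectiveE]). A minimizer of this expression has a = 0 if and only
    if the energy U = sum z_p^2 / w_p is at most lambda
    ([component_threshold]): near theta = 0 the profile objective changes by
    theta (lambda - U) at first order. Selection is therefore a
    deterministic test on the data ([minimizer_selection]); in particular the
    selection event is measurable.

    With n = m^2, z_p = a_p + e_p where the noise coefficients e_p have second
    moment V / n, V being the variance of the errors
    ([noise_coefficient_second_moment]). If the true component vanishes, then
    U = sum e_p^2 / w_p has expectation at most V / n because
    sum 1 / w_p <= 1, so U > lambda has probability at most V / (n lambda)
    ([spurious_selection]). Otherwise some fixed coefficient a_p is nonzero,
    the same for all large m, and U <= lambda with lambda small forces
    |e_p| >= |a_p| / 2, an event of probability at most 4 V / (n a_p^2)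
    ([missed_selection]). Both bounds are O(1 / (n lambda)) as lambda stays
    bounded, and n lambda tends to infinity. *)

(** * The trigonometric basis and its orthogonality on the grid *)

Section harmonics.
Context {R : realType}.
Implicit Types (m mu nu a : nat) (b t : R).

(** A cosine with a free phase covers sines and cosines at once, so that one
    product formula serves all pairs of basis functions. *)
Definition harmonic a b t : R := cos (2 * pi * a%:R * t + b).

Definition phase nu : R := if odd nu && (nu != 1%N) then - (pi / 2) else 0.

Definition amplitude m nu : R :=
  if (nu == 1%N) || (nu == m) then 1 else Num.sqrt 2.

Lemma gammaE m nu t : ~~ odd m -> (0 < m)%N ->
  gamma m nu t = amplitude m nu * harmonic nu./2 (phase nu) t.
Proof.
move=> m_even m_gt0; rewrite /gamma /amplitude /harmonic /phase.
case: eqVneq => [->|nu1] /=; first by rewrite mulr0 mul0r add0r cos0 mulr1.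
rewrite andbT; case: eqVneq => [->|num] /=.
  rewrite (negbTE m_even) addr0 mul1r; congr cos; congr (_ * _).
  rewrite -[in LHS](odd_double_half m) (negbTE m_even) add0n -mul2n natrM; ring.
by case: odd => /=; rewrite ?addr0 ?cosBpihalf.
Qed.

Lemma harmonicM a b a' b' t : (a' <= a)%N ->
  harmonic a b t * harmonic a' b' t
  = 2^-1 * (harmonic (a - a') (b - b') t + harmonic (a + a') (b + b') t).
Proof.
move=> a'a; rewrite /harmonic natrB// natrD.
set x := 2 * pi * a%:R * t + b; set y := 2 * pi * a'%:R * t + b'.
have -> : 2 * pi * (a%:R - a'%:R) * t + (b - b') = x - y by rewrite /x /y; ring.
have -> : 2 * pi * (a%:R + a'%:R) * t + (b + b') = x + y by rewrite /x /y; ring.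
by move: x y => x y; rewrite cosB cosD; field.
Qed.

(** A product of two basis functions is a sum of two harmonics, with the
    difference and the sum of the frequencies, both at most [m]. A linear
    functional that kills the harmonics of frequency strictly between 0 and [m]
    thus only sees equal frequencies, or twice the frequency of gamma_m. The
    average over the grid is the case [r = 1] (frequency [m] is aliased to 0),
    the integral over [0, 1] the case [r = 0]. *)
Lemma gamma_orthogonal (M : (R -> R) -> R) (r : R) m :
  ~~ odd m -> (0 < m)%N ->
  (forall c a b a' b', M (fun t => c * (harmonic a b t + harmonic a' b' t))
     = c * (M (harmonic a b) + M (harmonic a' b'))) ->
  (forall b, M (harmonic 0 b) = cos b) ->
  (forall a b, (0 < a < m)%N -> M (harmonic a b) = 0) ->
  (forall b, M (harmonic m b) = r * cos b) ->
  forall mu nu, (0 < mu <= m)%N -> (0 < nu <= m)%N ->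
  M (fun t => gamma m mu t * gamma m nu t)
  = if mu == nu then if mu == m then (1 + r) / 2 else 1 else 0.
Proof.
move=> m_even m_gt0 M_lin M0 M_mid M_top mu nu.
wlog le_numu : mu nu / (nu./2 <= mu./2)%N.
  move=> H hmu hnu; have [/H|/ltnW/H] := leqP nu./2 mu./2; first exact.
  move=> /(_ hnu hmu) E.
  transitivity (M (fun t => gamma m nu t * gamma m mu t)).
    by congr M; apply/funext => t; rewrite mulrC.
  by rewrite E eq_sym; case: eqVneq => // ->.
move=> /andP[mu_gt0 mu_le] /andP[nu_gt0 nu_le].
have -> : (fun t => gamma m mu t * gamma m nu t) = fun t =>
    amplitude m mu * amplitude m nu / 2 *
    (harmonic (mu./2 - nu./2) (phase mu - phase nu) t +
     harmonic (mu./2 + nu./2) (phase mu + phase nu) t).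
  apply/funext => t; rewrite !gammaE// mulrACA harmonicM//; ring.
rewrite M_lin.
have mE : m = m./2.*2 by rewrite -[LHS]odd_double_half (negbTE m_even).
have muE := odd_double_half mu; have nuE := odd_double_half nu.
have hmu : (mu./2 <= m./2)%N by rewrite half_leq.
have hnu : (nu./2 <= m./2)%N by rewrite half_leq.
have [munu|munu] := eqVneq mu nu.
  rewrite -munu subrr subnn M0 cos0 /amplitude addnn /phase.
  have [mu1|mu1] /= := eqVneq mu 1%N.
    by rewrite mu1 /= ?andbF addr0 M0 cos0; case: eqVneq m_even => [<-//|_ _]; field.
  have mu_half : (0 < mu./2)%N.
    by move: mu_gt0 mu1; rewrite -muE; case: odd; case: mu./2.
  have [mum|mum] := eqVneq mu m.
    rewrite mum (negbTE m_even) /= -mE addr0 M_top cos0; by field.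
  rewrite M_mid ?addr0 ?mulr1; last first.
    rewrite double_gt0 mu_half /= {1}mE ltn_double.
    rewrite ltn_neqAle hmu andbT; apply: contra mum => /eqP h.
    rewrite eqn_leq mu_le /= {1}mE -h -[X in (_ <= X)%N]muE leq_addl//.
  by rewrite -expr2 sqr_sqrtr// divff.
have [hh|hh] := eqVneq mu./2 nu./2.
  rewrite hh subnn M0.
  have nu_half : (0 < nu./2)%N.
    move: munu mu_gt0 nu_gt0; rewrite -muE -nuE hh.
    by case: (odd mu); case: (odd nu); case: nu./2.
  have nu1 : nu != 1%N by apply: contraTneq nu_half => ->.
  have mu1 : mu != 1%N by apply: contraTneq nu_half => h; rewrite -hh h.
  rewrite M_mid; last first.
    rewrite addnn double_gt0 nu_half /= {1}mE ltn_double.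
    rewrite ltn_neqAle hnu andbT; apply: contra munu => /eqP h.
    move: mu_le nu_le; rewrite mE -muE -nuE hh h.
    by case: (odd mu); case: (odd nu); rewrite // ?add0n ?add1n ?ltnn.
  rewrite /phase mu1 nu1 !andbT addr0.
  have : odd mu != odd nu.
    by apply: contra munu => /eqP h; rewrite -[X in X == _]muE hh h nuE.
  case: (odd mu); case: (odd nu) => // _.
    by rewrite subr0 cosN cos_pihalf mulr0.
  by rewrite sub0r opprK cos_pihalf mulr0.
have lt : (nu./2 < mu./2)%N by rewrite ltn_neqAle eq_sym hh.
have nu_lt : (nu./2 < m./2)%N := leq_trans lt hmu.
rewrite !M_mid ?addr0 ?mulr0//.
  rewrite addn_gt0 (leq_ltn_trans _ lt)//= mE -addnn.
  by rewrite -addnS leq_add.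
rewrite subn_gt0 lt /= (leq_ltn_trans (leq_subr _ _))// mE -addnn.
rewrite (leq_ltn_trans hmu)// -[X in (X < _)%N]addn0 ltn_add2l.
exact: leq_ltn_trans nu_lt.
Qed.

End harmonics.

Section discrete_mean.
Context {R : realType}.

Definition grid_mean (m : nat) (h : R -> R) : R :=
  m%:R^-1 * \sum_(k < m) h (grid k).

(* the sum telescopes once multiplied by 2 sin (pi a / m) *)
Lemma sum_harmonic (m a : nat) (b : R) : (0 < a < m)%N ->
  \sum_(k < m) harmonic a b (grid k) = 0.
Proof.
move=> /andP[a_gt0 am]; have m_gt0 : (0 < m)%N by exact: leq_trans am.
have m0 : m%:R != 0 :> R by rewrite pnatr_eq0 -lt0n.
pose x : R := pi * a%:R / m%:R.
have sinx : 0 < sin x.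
  apply: sin_gt0_pi; rewrite /x divr_gt0 ?mulr_gt0 ?pi_gt0 ?ltr0n//=.
  by rewrite ltr_pdivrMr ?ltr0n// ltr_pM2l ?pi_gt0// ltr_nat.
pose S (k : nat) : R := sin (2 * x * k%:R + b + x).
have step (k : 'I_m) : 2 * sin x * harmonic a b (grid k) = S k.+1 - S k.
  rewrite /harmonic /grid /S.
  have -> : 2 * pi * a%:R * (k.+1%:R / m%:R) + b = 2 * x * k.+1%:R + b.
    by rewrite /x; field.
  have -> : 2 * x * k%:R + b + x = 2 * x * k.+1%:R + b - x.
    by rewrite -natr1; ring.
  by rewrite sinD sinB; ring.
apply: (mulfI (_ : 2 * sin x != 0)); first by rewrite mulf_neq0 ?gt_eqF.
rewrite mulr0 mulr_sumr (eq_bigr (fun k : 'I_m => S k.+1 - S k)); last first.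
  by move=> k _; exact: step.
rewrite -(big_mkord xpredT (fun k => S k.+1 - S k)) telescope_sumr//.
apply/eqP; rewrite subr_eq0; apply/eqP; rewrite /S mulr0 add0r.
have -> : 2 * x * m%:R + b + x = (b + x) + (pi *+ 2) *+ a.
  by rewrite /x -(mulr_natr (pi *+ 2)) -(mulr_natr pi); field.
by rewrite (periodicn (@sinD2pi R)).
Qed.

Lemma grid_mean_harmonic_int (m : nat) (b : R) (a : nat) : (0 < m)%N ->
  grid_mean m (harmonic (m * a) b) = cos b.
Proof.
move=> m_gt0; have m0 : m%:R != 0 :> R by rewrite pnatr_eq0 -lt0n.
rewrite /grid_mean (eq_bigr (fun=> cos b)) => [|k _].
  by rewrite sumr_const card_ord -[cos b *+ m]mulr_natl mulKf.
rewrite /harmonic natrM.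
have gridK : grid k * m%:R = k.+1%:R :> R by rewrite /grid divfK.
have -> : 2 * pi * (m%:R * a%:R) * grid k + b = b + (pi *+ 2) *+ (a * k.+1).
  rewrite -(mulr_natr (pi *+ 2)) -(mulr_natr pi) natrM -gridK; ring.
by rewrite (periodicn (@cosD2pi R)).
Qed.

Lemma gamma_grid_orthonormal (m mu nu : nat) : ~~ odd m -> (0 < m)%N ->
  (0 < mu <= m)%N -> (0 < nu <= m)%N ->
  grid_mean m (fun t => gamma m mu t * gamma m nu t) = (mu == nu)%:R.
Proof.
move=> m_even m_gt0 hmu hnu.
rewrite (@gamma_orthogonal R (grid_mean m) 1)//.
- by case: eqVneq => // _; case: ifP => // _; rewrite divff.
- move=> c a b a' b'; rewrite /grid_mean -mulr_sumr big_split /=; ring.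
- by move=> b; rewrite -(muln0 m) grid_mean_harmonic_int.
- by move=> a b am; rewrite /grid_mean sum_harmonic// mulr0.
- by move=> b; rewrite mul1r -{2}(muln1 m) grid_mean_harmonic_int.
Qed.

End discrete_mean.

(** * Second derivatives and roughness penalties *)

Section penalties.
Context {R : realType}.
Local Notation leb := (@lebesgue_measure R).
Implicit Types (m mu nu a : nat) (b t : R) (r : seq nat) (c : nat -> R).

Definition frequency nu : R := 2 * pi * (nu./2)%:R.

Lemma derive1_harmonic_sum r c (a : nat -> nat) (b : nat -> R) :
  (fun t => \sum_(i <- r) c i * harmonic (a i) (b i) t)^`()%classic
  = fun t => \sum_(i <- r)
      c i * (2 * pi * (a i)%:R) * harmonic (a i) (b i + pi / 2) t.
Proof.
apply/funext => t; rewrite derive1E; apply: derive_val.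
elim: r => [|i r IH].
  rewrite big_nil; apply: (@is_derive_eq _ _ _ _ _ _ 0) => //.
  have -> : (fun x => \sum_(j <- [::]) c j * harmonic (a j) (b j) x) = cst 0.
    by apply/funext => x; rewrite big_nil.
  exact: is_derive_cst.
rewrite big_cons.
have -> : (fun x => \sum_(j <- i :: r) c j * harmonic (a j) (b j) x)
   = (fun x => c i * harmonic (a i) (b i) x)
     + (fun x => \sum_(j <- r) c j * harmonic (a j) (b j) x).
  by apply/funext => x; rewrite big_cons.
apply: is_deriveD.
rewrite /harmonic addrA cosDpihalf.
by apply: is_derive_eq; rewrite /GRing.scale /=; ring.
Qed.

(** Differentiating a harmonic shifts its phase by pi / 2, so two derivatives
    only change its sign and multiply by the squared frequency. *)
Lemma derive2_gamma_sum m r c : ~~ odd m -> (0 < m)%N ->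
  (fun t => \sum_(nu <- r) c nu * gamma m nu t)^`(2)%classic
  = fun t => \sum_(nu <- r) - (c nu * frequency nu ^+ 2) * gamma m nu t.
Proof.
move=> m_even m_gt0; rewrite derive1nS derive1n1.
have -> : (fun t => \sum_(nu <- r) c nu * gamma m nu t) =
   fun t => \sum_(nu <- r)
     (c nu * amplitude m nu) * harmonic nu./2 (phase nu) t.
  by apply/funext => t; apply: eq_bigr => nu _; rewrite gammaE// mulrA.
rewrite !derive1_harmonic_sum; apply/funext => t; apply: eq_bigr => nu _.
rewrite gammaE// /harmonic -addrA -splitr addrA cosDpi /frequency; ring.
Qed.

Definition unit_mean (h : R -> R) : R := \int[leb]_(t in `[0, 1]) h t.

Lemma unit_integrable (h : R -> R) : continuous h ->
  leb.-integrable `[0, 1] (EFin \o h).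
Proof.
move=> ch; apply: continuous_compact_integrable; first exact: segment_compact.
exact: continuous_subspaceT.
Qed.

Lemma unit_meanD (h k : R -> R) : continuous h -> continuous k ->
  unit_mean (fun t => h t + k t) = unit_mean h + unit_mean k.
Proof. by move=> ch ck; rewrite /unit_mean RintegralD//; exact: unit_integrable. Qed.

Lemma unit_meanZ x (h : R -> R) : continuous h ->
  unit_mean (fun t => x * h t) = x * unit_mean h.
Proof. by move=> ch; rewrite /unit_mean RintegralZl//; exact: unit_integrable. Qed.

Lemma continuous_sum (I : Type) (r : seq I) (h : I -> R -> R) :
  (forall i, continuous (h i)) -> continuous (fun t => \sum_(i <- r) h i t).
Proof.
move=> ch t; elim: r => [|i r IH].
  have -> : (fun t => \sum_(i <- [::]) h i t) = cst 0.
    by apply/funext => x; rewrite big_nil.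
  exact: cvg_cst.
have -> : (fun t => \sum_(j <- i :: r) h j t)
   = h i + (fun t => \sum_(j <- r) h j t).
  by apply/funext => x; rewrite big_cons.
by apply: cvgD; [exact: ch|exact: IH].
Qed.

Lemma continuous_sqr (h : R -> R) : continuous h ->
  continuous (fun t => h t ^+ 2).
Proof. by move=> ch t; apply: (cvgM (ch t) (ch t)). Qed.

Lemma unit_mean_sum (I : Type) (r : seq I) (x : I -> R) (h : I -> R -> R) :
  (forall i, continuous (h i)) ->
  unit_mean (fun t => \sum_(i <- r) x i * h i t)
  = \sum_(i <- r) x i * unit_mean (h i).
Proof.
move=> ch; have cxh i : continuous (fun t => x i * h i t).
  by move=> t; apply: cvgM; [exact: cvg_cst|exact: ch].
elim: r => [|i r IH].
  rewrite big_nil -[RHS](mul0r (unit_mean (cst 0))) -unit_meanZ; last first.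
    exact: cst_continuous.
  by congr unit_mean; apply/funext => t; rewrite big_nil mul0r.
rewrite big_cons -IH -unit_meanZ// -unit_meanD//; last exact: continuous_sum.
by congr unit_mean; apply/funext => t; rewrite big_cons.
Qed.

Lemma continuous_harmonic a b : continuous (@harmonic R a b).
Proof.
move=> t; rewrite /harmonic.
apply: (@continuous_comp _ _ _ (fun t => 2 * pi * a%:R * t + b) cos); last first.
  exact: continuous_cos.
by apply: cvgD; [apply: cvgM; [exact: cvg_cst|exact: cvg_id]|exact: cvg_cst].
Qed.

Lemma continuous_gamma m nu : ~~ odd m -> (0 < m)%N ->
  continuous (@gamma R m nu).
Proof.
move=> m_even m_gt0.
have -> : @gamma R m nu = fun t => amplitude m nu * harmonic nu./2 (phase nu) t.
  by apply/funext => t; rewrite gammaE.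
by move=> t; apply: cvgM; [exact: cvg_cst|exact: continuous_harmonic].
Qed.

Lemma unit_mean_harmonic0 b : unit_mean (harmonic 0 b) = cos b.
Proof.
rewrite /unit_mean (_ : harmonic 0 b = cst (cos b)); last first.
  by apply/funext => t; rewrite /harmonic mulr0 mul0r add0r.
have leb01 : leb `[0, 1]%classic = 1%E.
  by rewrite lebesgue_measure_itv /= lte_fin ltr01 oppr0 adde0.
by rewrite Rintegral_cst//= [X in fine X]leb01 mulr1.
Qed.

Lemma unit_mean_harmonic a b : (0 < a)%N -> unit_mean (harmonic a b) = 0.
Proof.
move=> a_gt0; pose w : R := 2 * pi * a%:R.
have w0 : w != 0 by rewrite !mulf_neq0 ?pnatr_eq0 -?lt0n// gt_eqF ?pi_gt0.
pose F t := w^-1 * harmonic a (b - pi / 2) t.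
have dF t : is_derive t 1 F (harmonic a b t).
  have -> : F = fun t => w^-1 * cos (w * t + (b - pi / 2)) by [].
  apply: is_derive_eq; rewrite /GRing.scale /= /harmonic addrA -/w.
  rewrite -cosDpihalf subrK; field => //.
have cF : continuous F.
  by move=> t; apply: cvgM; [exact: cvg_cst|exact: continuous_harmonic].
rewrite /unit_mean /Rintegral (@continuous_FTC2 _ _ F)//=.
- rewrite -mulrBr /harmonic mulr1 mulr0 add0r.
  have -> : 2 * pi * a%:R + (b - pi / 2) = (b - pi / 2) + pi *+ 2 *+ a.
    rewrite -(mulr_natr (pi *+ 2)) -(mulr_natr pi); ring.
  by rewrite (periodicn (@cosD2pi R)) subrr mulr0.
- exact/continuous_subspaceT/continuous_harmonic.
- split.
  + by move=> t _; exact: ex_derive.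
  + by apply: cvg_at_right_filter; exact: cF.
  + by apply: cvg_at_left_filter; exact: cF.
- by move=> t _; rewrite derive1E; exact: derive_val.
Qed.

Lemma gamma_unit_orthogonal m mu nu : ~~ odd m -> (0 < m)%N ->
  (0 < mu <= m)%N -> (0 < nu <= m)%N ->
  unit_mean (fun t => gamma m mu t * gamma m nu t)
  = if mu == nu then if mu == m then 2^-1 else 1 else 0.
Proof.
move=> m_even m_gt0 hmu hnu.
rewrite (@gamma_orthogonal R unit_mean 0)//; first by rewrite addr0 mul1r.
- move=> c a b a' b'; rewrite unit_meanZ ?unit_meanD//;
    do ?exact: continuous_harmonic.
  move=> t; apply: cvgD; exact: continuous_harmonic.
- exact: unit_mean_harmonic0.
- by move=> a b /andP[a_gt0 _]; exact: unit_mean_harmonic.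
- by move=> b; rewrite mul0r unit_mean_harmonic.
Qed.

(** Squared norm in L^2([0, 1]) of gamma_nu: the last function is a cosine
    without the factor sqrt 2. *)
Definition mass m nu : R := if nu == m then 2^-1 else 1.

Lemma unit_mean_sqr m r c : ~~ odd m -> (0 < m)%N ->
  uniq r -> {in r, forall nu, (0 < nu <= m)%N} ->
  unit_mean (fun t => (\sum_(nu <- r) c nu * gamma m nu t) ^+ 2)
  = \sum_(nu <- r) mass m nu * c nu ^+ 2.
Proof.
move=> m_even m_gt0 ur rm.
have -> : (fun t => (\sum_(nu <- r) c nu * gamma m nu t) ^+ 2)
  = fun t => \sum_(p <- [seq (mu, nu) | mu <- r, nu <- r])
      (c p.1 * c p.2) * (gamma m p.1 t * gamma m p.2 t).
  apply/funext => t; rewrite expr2 big_distrlr /= big_allpairs /=.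
  by apply: eq_bigr => mu _; apply: eq_bigr => nu _; rewrite mulrACA.
rewrite unit_mean_sum; last first.
  by move=> p t; apply: cvgM; exact: continuous_gamma.
rewrite big_allpairs big_seq [RHS]big_seq; apply: eq_bigr => mu mur.
rewrite (bigD1_seq mu)//= gamma_unit_orthogonal ?rm// eqxx /mass.
rewrite big_seq_cond big1 ?addr0 => [|nu /andP[nur numu]].
  by rewrite -expr2 mulrC.
by rewrite gamma_unit_orthogonal ?rm// eq_sym (negbTE numu) mulr0.
Qed.

(** The weight of a main-effect coefficient in the penalty; the value at
    the constant function is set to 1 so that a coefficient of the tensor
    basis always has the product of two weights. *)
Definition weight m nu : R :=
  if nu == 1%N then 1 else mass m nu * frequency nu ^+ 4.

Lemma mem_range m nu : (nu \in index_iota 2 m.+1) = (1 < nu <= m)%N.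
Proof. by rewrite mem_index_iota ltnS. Qed.

Lemma penalty1E m c : ~~ odd m -> (0 < m)%N ->
  penalty1 (fun t => \sum_(2 <= nu < m.+1) c nu * gamma m nu t)
  = \sum_(2 <= nu < m.+1) weight m nu * c nu ^+ 2.
Proof.
move=> m_even m_gt0; rewrite /penalty1 derive2_gamma_sum//.
rewrite [LHS]unit_mean_sqr ?iota_uniq//; last first.
  by move=> nu; rewrite mem_range => /andP[/ltnW -> ->].
rewrite big_nat [RHS]big_nat; apply: eq_bigr => nu /andP[nu2 _].
by rewrite /weight ifN ?gtn_eqF//; ring.
Qed.

Lemma penalty2E m (c : nat -> nat -> R) : ~~ odd m -> (0 < m)%N ->
  penalty2 (fun s t => \sum_(2 <= mu < m.+1) \sum_(2 <= nu < m.+1)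
     c mu nu * gamma m mu s * gamma m nu t)
  = \sum_(2 <= mu < m.+1) \sum_(2 <= nu < m.+1)
     weight m mu * weight m nu * c mu nu ^+ 2.
Proof.
move=> m_even m_gt0; rewrite /penalty2.
have r_bound : {in index_iota 2 m.+1, forall nu, (0 < nu <= m)%N}.
  by move=> nu; rewrite mem_range => /andP[/ltnW -> ->].
have d2t s : (fun t => \sum_(2 <= mu < m.+1) \sum_(2 <= nu < m.+1)
     c mu nu * gamma m mu s * gamma m nu t)^`(2)%classic
   = fun t => \sum_(2 <= nu < m.+1)
     - ((\sum_(2 <= mu < m.+1) c mu nu * gamma m mu s) * frequency nu ^+ 2)
       * gamma m nu t.
  have -> : (fun t => \sum_(2 <= mu < m.+1) \sum_(2 <= nu < m.+1)
      c mu nu * gamma m mu s * gamma m nu t) = fun t => \sum_(2 <= nu < m.+1)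
      (\sum_(2 <= mu < m.+1) c mu nu * gamma m mu s) * gamma m nu t.
    apply/funext => t; rewrite exchange_big.
    by apply: eq_bigr => nu _; rewrite mulr_suml.
  by rewrite derive2_gamma_sum.
under eq_Rintegral do under eq_Rintegral do under eq_fun do rewrite d2t.
have d2s t : (fun s => \sum_(2 <= nu < m.+1)
     - ((\sum_(2 <= mu < m.+1) c mu nu * gamma m mu s) * frequency nu ^+ 2)
       * gamma m nu t)^`(2)%classic
   = fun s => \sum_(2 <= nu < m.+1)
     (\sum_(2 <= mu < m.+1)
        (c mu nu * frequency mu ^+ 2 * frequency nu ^+ 2) * gamma m mu s)
     * gamma m nu t.
  have -> : (fun s => \sum_(2 <= nu < m.+1)
     - ((\sum_(2 <= mu < m.+1) c mu nu * gamma m mu s) * frequency nu ^+ 2)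
       * gamma m nu t) = fun s => \sum_(2 <= mu < m.+1)
     (\sum_(2 <= nu < m.+1) - (c mu nu * frequency nu ^+ 2 * gamma m nu t))
     * gamma m mu s.
    apply/funext => s; under [RHS]eq_bigr do rewrite mulr_suml.
    rewrite exchange_big; apply: eq_bigr => nu _ /=.
    rewrite mulNr !mulr_suml -sumrN; apply: eq_bigr => mu _; ring.
  rewrite derive2_gamma_sum//; apply/funext => s.
  under [RHS]eq_bigr do rewrite mulr_suml.
  rewrite [RHS]exchange_big; apply: eq_bigr => mu _ /=.
  rewrite mulr_suml -sumrN mulr_suml; apply: eq_bigr => nu _; ring.
under eq_Rintegral do under eq_Rintegral do rewrite d2s.
have inner s : \int[leb]_(t in `[0, 1]) (\sum_(2 <= nu < m.+1)
     (\sum_(2 <= mu < m.+1)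
        (c mu nu * frequency mu ^+ 2 * frequency nu ^+ 2) * gamma m mu s)
     * gamma m nu t) ^+ 2
   = \sum_(2 <= nu < m.+1) mass m nu * (\sum_(2 <= mu < m.+1)
        (c mu nu * frequency mu ^+ 2 * frequency nu ^+ 2) * gamma m mu s) ^+ 2.
  by rewrite [LHS]unit_mean_sqr ?iota_uniq.
under eq_Rintegral do rewrite inner.
rewrite [LHS]unit_mean_sum; last first.
  move=> nu; apply: continuous_sqr; apply: continuous_sum => mu s.
  by apply: cvgM; [exact: cvg_cst|exact: continuous_gamma].
rewrite [RHS]exchange_big [LHS]big_nat [RHS]big_nat; apply: eq_bigr => nu /andP[nu2 _].
rewrite unit_mean_sqr ?iota_uniq// mulr_sumr [LHS]big_nat [RHS]big_nat.
apply: eq_bigr => mu /andP[mu2 _].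
by rewrite /weight !ifN ?gtn_eqF//; ring.
Qed.

End penalties.

(** * Selection by thresholding *)

Section threshold.
Context {R : realFieldType} (I : eqType).
Implicit Types (r : seq I) (w z a : I -> R) (theta lambda : R).

Definition component_objective r w z lambda theta a : R :=
  \sum_(i <- r) (z i - a i) ^+ 2 + theta^-1 * (\sum_(i <- r) w i * a i ^+ 2)
  + lambda * theta.

Lemma component_objective0 r w z lambda theta a :
  {in r, forall i, a i = 0} -> component_objective r w z lambda theta a
  = \sum_(i <- r) z i ^+ 2 + lambda * theta.
Proof.
move=> a0; rewrite /component_objective.
have -> : \sum_(i <- r) w i * a i ^+ 2 = 0.
  by rewrite big_seq big1// => i /a0 ->; rewrite expr0n mulr0.
rewrite mulr0 addr0; congr (_ + _).
by apply: eq_big_seq => i /a0 ->; rewrite subr0.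
Qed.

(** The value at the competitor a = t z / w, the minimizer in a for small t up
    to terms of order t^2. *)
Lemma component_objective_shrunk r w z lambda t :
  {in r, forall i, 0 < w i} -> 0 < t ->
  component_objective r w z lambda t (fun i => t * (z i / w i))
  = \sum_(i <- r) z i ^+ 2 - t * (\sum_(i <- r) z i ^+ 2 / w i - lambda)
    + t ^+ 2 * \sum_(i <- r) z i ^+ 2 / w i ^+ 2.
Proof.
move=> w_gt0 t_gt0; rewrite /component_objective.
have -> : \sum_(i <- r) w i * (t * (z i / w i)) ^+ 2
          = t ^+ 2 * \sum_(i <- r) z i ^+ 2 / w i.
  rewrite mulr_sumr; apply: eq_big_seq => i /w_gt0 wi.
  by field; rewrite gt_eqF.
have -> : \sum_(i <- r) (z i - t * (z i / w i)) ^+ 2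
   = \sum_(i <- r) z i ^+ 2 - 2 * t * (\sum_(i <- r) z i ^+ 2 / w i)
     + t ^+ 2 * \sum_(i <- r) z i ^+ 2 / w i ^+ 2.
  rewrite !mulr_sumr -sumrB -big_split /=; apply: eq_big_seq => i /w_gt0 wi.
  by field; rewrite gt_eqF.
by field; rewrite gt_eqF.
Qed.

(** Completing the square in 2 z a <= theta z^2 / w + w a^2 / theta. *)
Lemma component_objective_ge r w z lambda theta a :
  {in r, forall i, 0 < w i} -> 0 < theta ->
  \sum_(i <- r) z i ^+ 2 - theta * (\sum_(i <- r) z i ^+ 2 / w i - lambda)
    + \sum_(i <- r) a i ^+ 2
  <= component_objective r w z lambda theta a.
Proof.
move=> w_gt0 theta_gt0; rewrite /component_objective.
suff : \sum_(i <- r) z i ^+ 2 - theta * (\sum_(i <- r) z i ^+ 2 / w i)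
      + \sum_(i <- r) a i ^+ 2
    <= \sum_(i <- r) (z i - a i) ^+ 2
      + theta^-1 * (\sum_(i <- r) w i * a i ^+ 2).
  by rewrite mulrBr [lambda * _]mulrC; lra.
rewrite !mulr_sumr -sumrB -!big_split /= big_seq [leRHS]big_seq.
apply: ler_sum => i /w_gt0 wi.
have wi0 : w i != 0 by rewrite gt_eqF.
have theta0 : theta != 0 by rewrite gt_eqF.
rewrite -subr_ge0.
have -> : (z i - a i) ^+ 2 + theta^-1 * (w i * a i ^+ 2)
    - (z i ^+ 2 - theta * (z i ^+ 2 / w i) + a i ^+ 2)
    = (theta * z i - w i * a i) ^+ 2 / (theta * w i) by field; rewrite wi0.
by rewrite divr_ge0 ?sqr_ge0// mulr_ge0 ?ltW.
Qed.

(** If U = sum z^2 / w exceeds lambda, a = 0 is beaten by a = t z / w for small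
    t; if not, [component_objective_ge] shows that a nonzero a costs at least
    sum a^2 more than the pair (0, 0). *)
Lemma component_threshold r w z lambda theta a :
  {in r, forall i, 0 < w i} -> 0 < lambda -> 0 <= theta ->
  (theta = 0 -> {in r, forall i, a i = 0}) ->
  (forall theta' a', 0 <= theta' -> (theta' = 0 -> {in r, forall i, a' i = 0}) ->
     component_objective r w z lambda theta a
     <= component_objective r w z lambda theta' a') ->
  {in r, forall i, a i = 0} <-> \sum_(i <- r) z i ^+ 2 / w i <= lambda.
Proof.
move=> w_gt0 lambda_gt0 theta_ge0 theta0 opt; split=> [a0|U_le].
  rewrite leNgt; apply/negP => lt_lambda.
  set U := \sum_(i <- r) _ in lt_lambda.
  pose V := \sum_(i <- r) z i ^+ 2 / w i ^+ 2.
  have V_ge0 : 0 <= V by apply: sumr_ge0 => i _; rewrite divr_ge0 ?sqr_ge0.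
  (* with this t the shrunk competitor lowers the objective by t^2 *)
  pose t := (U - lambda) / (V + 1).
  have V1_gt0 : 0 < V + 1 by rewrite ltr_wpDl.
  have t_gt0 : 0 < t by rewrite divr_gt0 ?subr_gt0.
  have tV : t * (V + 1) = U - lambda by rewrite /t divfK// gt_eqF.
  have : t = 0 -> {in r, forall i, t * (z i / w i) = 0} by move=> -> i _; rewrite mul0r.
  move=> /(opt t _ (ltW t_gt0)).
  rewrite component_objective0// component_objective_shrunk// -/U -/V -tV.
  have : 0 <= lambda * theta by rewrite mulr_ge0// ltW.
  nra.
move: theta_ge0; rewrite le_eqVlt => /predU1P[/esym/theta0//|theta_gt0] i ir.
have := opt 0 (fun=> 0) (lexx _) (fun _ _ _ => erefl).
rewrite (@component_objective0 r w z lambda 0 (fun=> 0))// mulr0 addr0.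
move=> /(le_trans (component_objective_ge _ _ _ w_gt0 theta_gt0)) H.
have a2_le0 : \sum_(i <- r) a i ^+ 2 <= 0.
  have : theta * (\sum_(i <- r) z i ^+ 2 / w i - lambda) <= 0.
    by rewrite mulr_ge0_le0 ?subr_le0// ltW.
  by move: H; lra.
have : \sum_(i <- r) a i ^+ 2 == 0.
  by rewrite eq_le a2_le0 sumr_ge0// => j _; exact: sqr_ge0.
rewrite psumr_eq0 => [|j _]; last exact: sqr_ge0.
by move=> /allP /(_ i ir) /=; rewrite sqrf_eq0 => /eqP.
Qed.

End threshold.

Section weights.
Context {R : realType}.
Implicit Types (m nu : nat).

Lemma frequency_ge nu : (1 < nu)%N -> 2 * (nu.-1)%:R <= frequency nu :> R.
Proof.
move=> nu1; rewrite /frequency -mulrA ler_pM2l//.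
apply: (@le_trans _ _ (2 * (nu./2)%:R)); last first.
  by rewrite ler_wpM2r// pi_ge2.
rewrite -natrM ler_nat mul2n -[X in (X.-1 <= _)%N]odd_double_half.
by case: odd => //=; rewrite add0n leq_pred.
Qed.

Lemma weight_ge m nu : (1 < nu)%N -> (nu.-1 * nu)%:R <= weight m nu :> R.
Proof.
move=> nu1; rewrite /weight ifN ?gtn_eqF//.
have := frequency_ge nu1; case: nu nu1 => [//|nu] /=; rewrite ltnS => nu_gt0 f_ge.
have nuR : 1 <= nu%:R :> R by rewrite ler1n.
have f4 : (2 * nu%:R) ^+ 4 <= (frequency nu.+1) ^+ 4 :> R.
  have n2 : 0 <= 2 * nu%:R :> R by rewrite mulr_ge0.
  by rewrite lerXn2r// nnegrE// (le_trans n2).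
apply: (@le_trans _ _ (2^-1 * frequency nu.+1 ^+ 4)).
  apply: (@le_trans _ _ (2^-1 * (2 * nu%:R) ^+ 4)); last by rewrite ler_pM2l.
  rewrite natrM -natr1.
  have -> : 2^-1 * (2 * nu%:R) ^+ 4 = 8 * nu%:R ^+ 4 :> R by field.
  have : 1 <= nu%:R ^+ 2 :> R by rewrite exprn_ege1.
  have : nu%:R <= nu%:R ^+ 2 :> R by rewrite -[leLHS]expr1 ler_weXn2l.
  have -> : nu%:R ^+ 4 = (nu%:R ^+ 2) ^+ 2 :> R by rewrite -exprM.
  by nra.
rewrite ler_wpM2r//; first by rewrite (le_trans _ f4)// exprn_ge0// mulr_ge0.
by rewrite /mass; case: ifP => // _; lra.
Qed.

Lemma weight_gt0 m nu : (0 < nu)%N -> 0 < weight m nu :> R.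
Proof.
have [-> _|nu1 nu_gt0] := eqVneq nu 1%N; first by rewrite /weight eqxx.
have nu_gt1 : (1 < nu)%N by rewrite ltn_neqAle eq_sym nu1.
apply: lt_le_trans (weight_ge m nu_gt1).
by rewrite ltr0n muln_gt0 nu_gt0 andbT -ltnS prednK.
Qed.

Lemma weight_le m nu : weight m nu <= 1 + frequency nu ^+ 4 :> R.
Proof.
have f4 : 0 <= frequency nu ^+ 4 :> R by rewrite exprn_even_ge0.
rewrite /weight; case: ifP => _; first by rewrite lerDl.
apply: (@le_trans _ _ (frequency nu ^+ 4)); last by rewrite lerDr.
rewrite ler_piMl// /mass; case: ifP => // _; lra.
Qed.

(** The fourth powers dominate nu (nu - 1), whose inverses telescope. *)
Lemma sum_weightV m : (0 < m)%N ->
  \sum_(2 <= nu < m.+1) (weight m nu)^-1 <= 1 :> R.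
Proof.
move=> m_gt0.
apply: (@le_trans _ _ (\sum_(2 <= nu < m.+1) ((nu.-1)%:R^-1 - nu%:R^-1))).
  rewrite big_nat [leRHS]big_nat; apply: ler_sum => nu /andP[nu1 _].
  case: nu nu1 => [//|nu] /=; rewrite ltnS => nu_gt0.
  have -> : nu%:R^-1 - nu.+1%:R^-1 = (nu * nu.+1)%:R^-1 :> R.
    have nu0 : nu%:R != 0 :> R by rewrite pnatr_eq0 -lt0n.
    by rewrite natrM -natr1; field; rewrite nu0 natr1 pnatr_eq0.
  rewrite lef_pV2 ?posrE ?weight_gt0 ?ltr0n ?muln_gt0 ?nu_gt0//.
  exact: (@weight_ge m nu.+1).
have -> : \sum_(2 <= nu < m.+1) ((nu.-1)%:R^-1 - nu%:R^-1) = 1 - m%:R^-1 :> R.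
  case: m m_gt0 => // m _; rewrite big_add1 /= -[LHS]opprK -sumrN.
  rewrite (eq_bigr (fun nu => nu.+1%:R^-1 - nu%:R^-1)) => [|nu _]; last first.
    by rewrite opprB.
  by rewrite telescope_sumr// invr1 opprB.
by rewrite gerBl invr_ge0.
Qed.

End weights.

(** * Second moments of Gaussian noise *)

Section normal_moments.
Context {R : realType}.
Local Notation leb := (@lebesgue_measure R).
Local Open Scope ereal_scope.

Lemma normal_prob_opp (sigma : R) (A : set R) : sigma != 0%R -> measurable A ->
  normal_prob 0 sigma (-%R @^-1` A) = normal_prob 0 sigma A.
Proof.
move=> sigma0 mA; rewrite /normal_prob.
transitivity (\int[leb]_(x in -%R @^-1` A)
    (normal_pdf 0 sigma (- x))%:E).
  apply: eq_integral => x _; congr EFin.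
  by rewrite /= !normal_pdfE// /normal_fun !subr0 sqrrN.
have mpdf : measurable_fun A (fun x => (normal_pdf 0 sigma x)%:E).
  apply/measurable_EFinP; apply: measurable_funTS.
  exact: measurable_normal_pdf.
transitivity (\int[pushforward leb (-%R : _ -> measurableTypeR R)]_(x in A)
    (normal_pdf 0 sigma x)%:E).
  rewrite ge0_integral_pushforward// => x _.
  by rewrite lee_fin normal_pdf_ge0.
by apply: eq_measure_integral => B mB _; exact: lebesgue_measureN.
Qed.

(** The Gaussian density is a Radon-Nikodym derivative of [normal_prob]. *)
Lemma ge0_integral_normal_prob (sigma : R) (h : R -> \bar R) :
  measurable_fun setT h -> (forall x, 0 <= h x) ->
  \int[normal_prob 0 sigma]_x h x
  = \int[leb]_x (h x * (normal_pdf 0 sigma x)%:E).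
Proof.
move=> mh h_ge0; have dom := @normal_prob_dominates R 0 sigma.
rewrite -(Radon_Nikodym_SigmaFinite.change_of_variables dom)//.
have mpdf : measurable_fun setT (fun x => (normal_pdf 0 sigma x)%:E).
  by apply/measurable_EFinP; exact: measurable_normal_pdf.
have ig := Radon_Nikodym_SigmaFinite.f_integrable dom.
apply: ae_eq_integral => //.
- by apply: emeasurable_funM => //; exact: measurable_int ig.
- exact: emeasurable_funM.
- apply: ae_eqe_mul2l; apply: integral_ae_eq => // A _ mA.
  by rewrite -Radon_Nikodym_SigmaFinite.f_integral.
Qed.

(** Up to a constant, x^2 times the density is dominated by the density with
    twice the standard deviation. *)
Lemma normal_second_moment_lty (sigma : R) : sigma != 0%R ->
  \int[normal_prob 0 sigma]_x (x ^+ 2)%:E < +oo.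
Proof.
move=> sigma0; rewrite ge0_integral_normal_prob; first last.
- by move=> x; rewrite lee_fin sqr_ge0.
- by apply/measurable_EFinP; exact: exprn_measurable.
pose tau := (2 * sigma)%R; have tau0 : tau != 0%R by rewrite mulf_neq0.
pose c := (8 / 3 * sigma ^+ 2 * normal_peak sigma / normal_peak tau)%R.
have sigma2 : (0 < sigma ^+ 2)%R by rewrite exprn_even_gt0.
have c_ge0 : (0 <= c)%R.
  by rewrite /c divr_ge0 ?normal_peak_ge0// mulr_ge0 ?normal_peak_ge0// mulr_ge0// ltW.
apply: (@le_lt_trans _ _ (\int[leb]_x (c%:E * (normal_pdf 0 tau x)%:E))).
  apply: ge0_le_integral => //.
  - move=> x _; rewrite -EFinM lee_fin mulr_ge0 ?sqr_ge0 ?normal_pdf_ge0//.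
  - apply/measurable_EFinP; apply: measurable_funM; first exact: exprn_measurable.
    exact: measurable_normal_pdf.
  - apply/measurable_EFinP; apply: measurable_funM => //.
    exact: measurable_normal_pdf.
  - move=> x _; rewrite -!EFinM lee_fin !normal_pdfE// /normal_fun !subr0 /c.
    rewrite [leRHS]mulrA divfK ?gt_eqF ?normal_peak_gt0//.
    pose u := (3 * x ^+ 2 / (8 * sigma ^+ 2))%R.
    have -> : (- x ^+ 2 / (tau ^+ 2 *+ 2) = - x ^+ 2 / (sigma ^+ 2 *+ 2) + u)%R.
      rewrite /tau /u; field.
      by rewrite sigma0.
    rewrite expRD.
    have u_le : (u <= expR u)%R by rewrite (le_trans _ (expR_ge1Dx u))// lerDr.
    have -> : (x ^+ 2 = 8 / 3 * (sigma ^+ 2 * u))%R.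
      by rewrite /u; field; rewrite sigma0.
    set E := expR (- _ / _)%R.
    rewrite [leLHS]mulrCA.
    rewrite [leRHS](_ : _ = normal_peak sigma
      * (8 / 3 * (sigma ^+ 2 * expR u) * E))%R; last by ring.
    rewrite ler_wpM2l ?normal_peak_ge0// ler_wpM2r ?expR_ge0//.
    by rewrite ler_wpM2l// ler_pM2l.
rewrite integralZl//; last exact: integrable_normal_pdf.
by rewrite integral_normal_pdf mule1 ltry.
Qed.

End normal_moments.

Section white_noise.
Context d (T : measurableType d) (R : realType) (P : probability T R).
Context (sigma : R) (sigma_neq0 : sigma != 0).
Local Open Scope ereal_scope.

Definition noise_variance : R := fine (\int[normal_prob 0 sigma]_x (x ^+ 2)%:E).

Lemma normal_second_moment (X : {RV P >-> R}) : centered_normal sigma X ->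
  \int[P]_w (X w ^+ 2)%:E = noise_variance%:E.
Proof.
move=> normX; rewrite /noise_variance fineK; last first.
  rewrite ge0_fin_numE ?normal_second_moment_lty//.
  by apply: integral_ge0 => x _; rewrite lee_fin sqr_ge0.
pose X' : T -> measurableTypeR R := X.
have mX : measurable_fun setT X'.
  by move=> mT B mB; exact: (@measurable_funPT _ _ _ _ X mT B mB).
pose Y : {mfun T >-> measurableTypeR R} := mfun_Sub (mem_set mX).
transitivity (\int[pushforward P Y]_x (x ^+ 2)%:E).
  rewrite ge0_integral_pushforward//.
  - by apply/measurable_EFinP; exact: exprn_measurable.
  - by move=> x; rewrite lee_fin sqr_ge0.
by apply: eq_measure_integral => A mA _; exact: normX.
Qed.

Lemma normal_product_integrable (X Y : {RV P >-> R}) :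
  centered_normal sigma X -> centered_normal sigma Y ->
  P.-integrable setT (fun w => (X w * Y w)%:E).
Proof.
move=> normX normY.
have int2 (Z : {RV P >-> R}) : centered_normal sigma Z ->
    P.-integrable setT (fun w => (Z w ^+ 2)%:E).
  move=> normZ; apply/integrableP; split.
    by apply/measurable_EFinP; apply: measurable_funX.
  rewrite (eq_integral (fun w => (Z w ^+ 2)%:E)) => [|w _].
    by rewrite normal_second_moment// ltry.
  by rewrite gee0_abs// lee_fin sqr_ge0.
apply: (@le_integrable _ _ _ _ _ _ _ (fun w => (X w ^+ 2)%:E + (Y w ^+ 2)%:E)) => //.
- by apply/measurable_EFinP; exact: measurable_funM.
- move=> w _; rewrite -EFinD !abse_EFin lee_fin normrM.
  rewrite [leRHS]ger0_norm ?addr_ge0 ?sqr_ge0//.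
  rewrite -(real_normK (num_real (X w))) -(real_normK (num_real (Y w))).
  have := sqr_ge0 (`|X w| - `|Y w|)%R.
  have := sqr_ge0 (`|X w| + `|Y w|)%R.
  nra.
- by apply: integrableD => //; exact: int2.
Qed.

Definition independent_pair (X Y : {RV P >-> R}) :=
  forall A B, measurable A -> measurable B ->
    P (X @^-1` A `&` Y @^-1` B) = P (X @^-1` A) * P (Y @^-1` B).

Lemma mutually_independent_pair (I : finType) (X : I -> {RV P >-> R}) i j :
  mutually_independent X -> i != j -> independent_pair (X i) (X j).
Proof.
move=> indX ij A B mA mB.
pose C k := if k == i then A else B.
have mC k : measurable (C k) by rewrite /C; case: ifP.
have := indX [set i; j]%SET C mC.
rewrite big_setU1 ?inE//= big_set1 /C eqxx eq_sym (negbTE ij) => <-.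
congr (P _); apply/seteqP; split=> w /=.
  move=> [Aw Bw] k /=; rewrite !inE => /orP[/eqP->|/eqP->].
    by rewrite eqxx.
  by rewrite eq_sym (negbTE ij).
move=> H; have := H i; have := H j; rewrite /= !inE !eqxx orbT /=.
by rewrite eq_sym (negbTE ij) => /(_ isT) ? /(_ isT).
Qed.

(** (X, Y) and (- X, Y) have the same law. *)
(** By symmetry of the normal law and independence, (X, Y) and (- X, Y) have the
    same law, so the expectation of X Y equals its opposite. *)
Lemma independent_normal_product (X Y : {RV P >-> R}) :
  centered_normal sigma X -> centered_normal sigma Y -> independent_pair X Y ->
  \int[P]_w (X w * Y w)%:E = 0.
Proof.
move=> normX normY indXY.
have mphi : measurable_fun setT (fun w => (X w, Y w)) by exact: measurable_fun_pair.
have mpsi : measurable_fun setT (fun w => (- X w, Y w)%R).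
  by apply: measurable_fun_pair => //; exact: measurableT_comp.
pose phi : {mfun T >-> (R * R)%type} := mfun_Sub (mem_set mphi).
pose psi : {mfun T >-> (R * R)%type} := mfun_Sub (mem_set mpsi).
have law A B : measurable A -> measurable B ->
    pushforward P psi (A `*` B) = distribution P X A * distribution P Y B.
  move=> mA mB; have mNA : measurable (-%R @^-1` A).
    by rewrite -[X in measurable X]setTI; exact: (oppr_measurable measurableT).
  transitivity (P (X @^-1` (-%R @^-1` A) `&` Y @^-1` B)); first by [].
  rewrite indXY//; congr (_ * _).
  by rewrite [LHS]normX// [RHS]normX// normal_prob_opp.
have lawE A : measurable A -> pushforward P phi A = pushforward P psi A.
  move=> mA.
  rewrite -(product_measure_unique (m1 := distribution P X)
    (m2 := distribution P Y) law)//.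
  have law' C D : measurable C -> measurable D ->
      pushforward P phi (C `*` D) = distribution P X C * distribution P Y D.
    by move=> mC mD; rewrite -[RHS]indXY.
  by rewrite -(product_measure_unique (m1 := distribution P X)
    (m2 := distribution P Y) law').
have mprod : measurable_fun setT (fun p : R * R => (p.1 * p.2)%:E).
  by apply/measurable_EFinP; apply: measurable_funM.
have intXY := normal_product_integrable normX normY.
have NE : (fun w => (- X w * Y w)%:E) = (fun w => (-1)%:E * (X w * Y w)%:E).
  by apply/funext => w; rewrite -EFinM mulN1r mulNr.
have intNXY : P.-integrable setT (fun w => (- X w * Y w)%:E).
  by rewrite NE; exact: integrableZl.
have E : \int[P]_w (X w * Y w)%:E = \int[P]_w (- X w * Y w)%:E.
  rewrite -[LHS](@integral_pushforward _ _ _ _ _ phi _ P setT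
    (fun p => (p.1 * p.2)%:E))//.
  rewrite -[RHS](@integral_pushforward _ _ _ _ _ psi _ P setT
    (fun p => (p.1 * p.2)%:E))//.
  by apply: eq_measure_integral => A mA _; exact: lawE.
move: E; rewrite NE integralZl// mulN1e.
have := integrable_fin_num measurableT intXY.
case: (\int[P]_w _) => // x _ [] xN; congr EFin; lra.
Qed.

(** Only the diagonal terms of the expanded square survive. *)
Lemma white_noise_second_moment (I : finType) (X : I -> {RV P >-> R})
    (x : I -> R) :
  (forall i, centered_normal sigma (X i)) -> mutually_independent X ->
  \int[P]_w ((\sum_i x i * X i w) ^+ 2)%:E
  = (noise_variance * \sum_i x i ^+ 2)%:E.
Proof.
move=> normX indX.
transitivity (\int[P]_w \sum_(p : I * I)
   (x p.1 * x p.2)%:E * (X p.1 w * X p.2 w)%:E).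
  apply: eq_integral => w _; rewrite expr2 big_distrlr /=.
  rewrite pair_big /= -sumEFin; apply: eq_bigr => p _.
  by rewrite -EFinM mulrACA.
rewrite integral_sum//; last first.
  by move=> p; apply: integrableZl => //; exact: normal_product_integrable.
rewrite -(pair_big xpredT xpredT (fun i j => \int[P]_w
   ((x i * x j)%:E * (X i w * X j w)%:E))) /=.
rewrite mulr_sumr -sumEFin; apply: eq_bigr => i _.
rewrite (bigD1 i)//= integralZl//; last exact: normal_product_integrable.
rewrite -expr2 normal_second_moment// big1 ?adde0 => [|j ji].
  by rewrite -EFinM mulrC.
rewrite integralZl//; last exact: normal_product_integrable.
rewrite independent_normal_product ?mule0//.
by apply: mutually_independent_pair => //; rewrite eq_sym.
Qed.

End white_noise.

(** * The objective in coordinates *)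

Section coefficients.
Context {R : realType}.
Implicit Types (m : nat) (p q : nat * nat) (r : seq (nat * nat)).

(** The three components are spanned by disjoint blocks of the tensor basis
    indexed by pairs; index 1 stands for the constant function. *)
Definition block1 m := [seq (nu, 1%N) | nu <- index_iota 2 m.+1].
Definition block2 m := [seq (1%N, nu) | nu <- index_iota 2 m.+1].
Definition block12 m :=
  [seq (mu, nu) | mu <- index_iota 2 m.+1, nu <- index_iota 2 m.+1].
Definition all_indices m := (1%N, 1%N) :: block1 m ++ block2 m ++ block12 m.

Lemma mem_block1 m p : (p \in block1 m) = (1 < p.1 <= m)%N && (p.2 == 1%N).
Proof.
apply/mapP/andP => [[nu nur ->]|]; first by rewrite -mem_range.
by case: p => mu nu /= [mur /eqP ->]; exists mu; rewrite ?mem_range.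
Qed.

Lemma mem_block2 m p : (p \in block2 m) = (p.1 == 1%N) && (1 < p.2 <= m)%N.
Proof.
apply/mapP/andP => [[nu nur ->]|]; first by rewrite -mem_range.
by case: p => mu nu /= [/eqP -> nur]; exists nu; rewrite ?mem_range.
Qed.

Lemma mem_block12 m p :
  (p \in block12 m) = (1 < p.1 <= m)%N && (1 < p.2 <= m)%N.
Proof.
apply/allpairsP/andP => [[[mu nu] /= [mur nur ->]]|[mur nur]].
  by rewrite -!mem_range.
by exists p; rewrite !mem_range; split=> //; case: p {mur nur}.
Qed.

Lemma all_indices_uniq m : uniq (all_indices m).
Proof.
rewrite /all_indices /= !cat_uniq mem_cat mem_cat mem_block1 mem_block2.
rewrite mem_block12 /= !map_inj_uniq ?iota_uniq; try by move=> x y [].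
rewrite allpairs_uniq ?iota_uniq //=; last by move=> [x y] [x' y'] _ _ [-> ->].
rewrite andbT; apply/andP; split.
  apply/hasPn => p; rewrite mem_cat mem_block1 mem_block2 mem_block12.
  by case: (eqVneq p.2 1%N) => [->|_]; rewrite ?andbF//= orbF => /andP[/eqP ->].
apply/hasPn => p; rewrite mem_block2 mem_block12 => /andP[/andP[p1 _] _].
by rewrite gtn_eqF.
Qed.

Definition valid m p := (0 < p.1 <= m)%N && (0 < p.2 <= m)%N.

Lemma all_indices_valid m : (0 < m)%N -> {in all_indices m, forall p, valid m p}.
Proof.
move=> m_gt0 p; rewrite /all_indices inE !mem_cat mem_block1 mem_block2.
rewrite mem_block12 /valid => /predU1P[->//=|]; first by rewrite m_gt0.
move=> /orP[/andP[/andP[/ltnW -> ->] /eqP ->]//|].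
move=> /orP[/andP[/eqP -> /andP[/ltnW -> ->]]|]; first by rewrite m_gt0.
by move=> /andP[/andP[/ltnW -> ->] /andP[/ltnW -> ->]].
Qed.

Lemma block1_sub m : {subset block1 m <= all_indices m}.
Proof. by move=> p pr; rewrite inE !mem_cat pr orbT. Qed.
Lemma block2_sub m : {subset block2 m <= all_indices m}.
Proof. by move=> p pr; rewrite inE !mem_cat pr !orbT. Qed.
Lemma block12_sub m : {subset block12 m <= all_indices m}.
Proof. by move=> p pr; rewrite inE !mem_cat pr !orbT. Qed.

Lemma blocks_uniq m :
  [/\ uniq (block1 m), uniq (block2 m) & uniq (block12 m)].
Proof.
have := all_indices_uniq m; rewrite /all_indices /= !cat_uniq.
by move=> /and3P[_ -> /and4P[_ -> _ ->]].
Qed.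

Definition tensor m p (s t : R) : R := gamma m p.1 s * gamma m p.2 t.

Definition grid_mean2 m (F : 'I_m -> 'I_m -> R) : R :=
  (m ^ 2)%:R^-1 * \sum_(k < m) \sum_(l < m) F k l.

Definition coefficient m (y : 'I_m -> 'I_m -> R) p : R :=
  grid_mean2 (fun k l => y k l * tensor m p (grid k) (grid l)).

Definition combination m r (a : nat * nat -> R) (s t : R) : R :=
  \sum_(p <- r) a p * tensor m p s t.

Lemma eq_grid_mean2 m (F G : 'I_m -> 'I_m -> R) :
  (forall k l, F k l = G k l) -> grid_mean2 F = grid_mean2 G.
Proof.
move=> FG; rewrite /grid_mean2; congr (_ * _).
by apply: eq_bigr => k _; apply: eq_bigr => l _.
Qed.

Lemma grid_mean2_linear m (I : Type) (r : seq I) (a : I -> R)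
    (F : I -> 'I_m -> 'I_m -> R) :
  grid_mean2 (fun k l => \sum_(i <- r) a i * F i k l)
  = \sum_(i <- r) a i * grid_mean2 (F i).
Proof.
rewrite /grid_mean2; under eq_bigr do rewrite exchange_big /=.
rewrite exchange_big mulr_sumr /=; apply: eq_bigr => i _.
rewrite mulrCA; congr (_ * _); rewrite mulr_sumr; apply: eq_bigr => k _.
by rewrite mulr_sumr.
Qed.

Lemma grid_mean2D m (F G : 'I_m -> 'I_m -> R) :
  grid_mean2 (fun k l => F k l + G k l) = grid_mean2 F + grid_mean2 G.
Proof.
rewrite /grid_mean2 -mulrDr -big_split; congr (_ * _).
by apply: eq_bigr => k _; rewrite -big_split.
Qed.

Lemma grid_mean2Z m x (F : 'I_m -> 'I_m -> R) :
  grid_mean2 (fun k l => x * F k l) = x * grid_mean2 F.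
Proof.
rewrite /grid_mean2 mulrCA; congr (_ * _); rewrite mulr_sumr.
by apply: eq_bigr => k _; rewrite mulr_sumr.
Qed.

Lemma coefficientD m (y z : 'I_m -> 'I_m -> R) p :
  coefficient (fun k l => y k l + z k l) p = coefficient y p + coefficient z p.
Proof.
by rewrite /coefficient -grid_mean2D; apply: eq_grid_mean2 => k l; rewrite mulrDl.
Qed.

Lemma tensor_orthonormal m p q : ~~ odd m -> valid m p -> valid m q ->
  grid_mean2 (fun k l : 'I_m =>
    tensor m p (grid k) (grid l) * tensor m q (grid k) (grid l))
  = (p == q)%:R.
Proof.
move=> m_even /andP[p1 p2] /andP[q1 q2].
have m_gt0 : (0 < m)%N by case/andP: p1 => /leq_trans; apply.
have -> : (p == q)%:R = (p.1 == q.1)%:R * (p.2 == q.2)%:R :> R.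
  by rewrite -natrM mulnb; case: p q {p1 p2 q1 q2} => [? ?] [? ?].
rewrite -(gamma_grid_orthonormal (R := R) m_even m_gt0 p1 q1).
rewrite -(gamma_grid_orthonormal (R := R) m_even m_gt0 p2 q2).
rewrite /grid_mean mulrACA -invfM -natrM mulnn; congr (_ * _).
rewrite big_distrlr /=; apply: eq_bigr => k _; apply: eq_bigr => l _.
by rewrite /tensor mulrACA.
Qed.

Lemma grid_mean2_combination m r a (y : 'I_m -> 'I_m -> R) :
  grid_mean2 (fun k l => y k l * combination m r a (grid k) (grid l))
  = \sum_(p <- r) a p * coefficient y p.
Proof.
rewrite -grid_mean2_linear; apply: eq_grid_mean2 => k l.
by rewrite mulr_sumr; apply: eq_bigr => p _; rewrite mulrCA.
Qed.

Lemma coefficient_combination m r a p : ~~ odd m -> uniq r ->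
  {in r, forall q, valid m q} -> valid m p ->
  coefficient (fun k l : 'I_m => combination m r a (grid k) (grid l)) p
  = if p \in r then a p else 0.
Proof.
move=> m_even ur rv pv.
transitivity (\sum_(q <- r) a q * (p == q)%:R).
  rewrite /coefficient.
  under eq_grid_mean2 do rewrite mulrC.
  rewrite grid_mean2_combination big_seq [RHS]big_seq.
  by apply: eq_bigr => q /rv qv; rewrite /coefficient tensor_orthonormal.
case: ifP => [pr|pNr].
  rewrite (bigD1_seq p)//= eqxx mulr1 big1 ?addr0// => q.
  by rewrite eq_sym => /negbTE ->; rewrite mulr0.
rewrite big_seq big1// => q qr; case: eqVneq qr => [<-|_ _]; first by rewrite pNr.
by rewrite mulr0.
Qed.

(** Pythagoras: the part of the data outside the span contributes a constant. *)
Lemma residual_mean m r a (y : 'I_m -> 'I_m -> R) : ~~ odd m -> uniq r ->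
  {in r, forall q, valid m q} ->
  grid_mean2 (fun k l => (y k l - combination m r a (grid k) (grid l)) ^+ 2)
  = grid_mean2 (fun k l => y k l ^+ 2) - \sum_(p <- r) coefficient y p ^+ 2
    + \sum_(p <- r) (coefficient y p - a p) ^+ 2.
Proof.
move=> m_even ur rv; pose g k l := combination m r a (@grid R m k) (@grid R m l).
transitivity (grid_mean2 (fun k l => y k l ^+ 2)
   + (-2 * grid_mean2 (fun k l => y k l * g k l)
      + grid_mean2 (fun k l => g k l * g k l))).
  rewrite -grid_mean2Z -!grid_mean2D; apply: eq_grid_mean2 => k l.
  by rewrite /g; ring.
rewrite !grid_mean2_combination -addrA; congr (_ + _).
rewrite mulr_sumr -sumrN -!big_split /= big_seq [RHS]big_seq.
apply: eq_bigr => p pr.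
by rewrite coefficient_combination ?pr ?rv//; ring.
Qed.

Lemma combination_eq0 m r a : ~~ odd m -> uniq r ->
  {in r, forall q, valid m q} ->
  (forall k l : 'I_m, combination m r a (grid k) (grid l) = 0) ->
  {in r, forall p, a p = 0}.
Proof.
move=> m_even ur rv g0 p pr.
have := coefficient_combination a m_even ur rv (rv p pr); rewrite pr => <-.
rewrite /coefficient /grid_mean2 big1 ?mulr0// => k _.
by rewrite big1// => l _; rewrite g0 mul0r.
Qed.

Lemma combination0 m r a s t : {in r, forall p, a p = 0} ->
  combination m r a s t = 0.
Proof.
by move=> a0; rewrite /combination big_seq big1// => p /a0 ->; rewrite mul0r.
Qed.

(** All of F_m is parametrized by one family of coefficients on pairs, with the
    decomposition read off the blocks. *)
Definition anova_of m (a : nat * nat -> R) : anova R :=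
  Anova (a (1%N, 1%N))
    (fun t => \sum_(2 <= nu < m.+1) a (nu, 1%N) * gamma m nu t)
    (fun t => \sum_(2 <= nu < m.+1) a (1%N, nu) * gamma m nu t)
    (fun s t => \sum_(2 <= mu < m.+1) \sum_(2 <= nu < m.+1)
       a (mu, nu) * gamma m mu s * gamma m nu t).

Lemma Fspace_anova_of m a : Fspace m (anova_of m a).
Proof.
split; first by exists (fun nu => a (nu, 1%N)).
  by exists (fun nu => a (1%N, nu)).
by exists (fun mu nu => a (mu, nu)).
Qed.

Lemma FspaceP m (g : anova R) : Fspace m g -> exists a, g = anova_of m a.
Proof.
case: g => b g1 g2 g12 [/= [c1 ->] [c2 ->] [c12 ->]].
exists (fun p => if p == (1%N, 1%N) then b else
  if p.2 == 1%N then c1 p.1 else if p.1 == 1%N then c2 p.2 else c12 p.1 p.2).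
rewrite /anova_of; congr Anova.
- apply/funext => t; rewrite big_nat [RHS]big_nat.
  by apply: eq_bigr => nu /andP[nu1 _]; rewrite xpair_eqE gtn_eqF.
- apply/funext => t; rewrite big_nat [RHS]big_nat.
  by apply: eq_bigr => nu /andP[nu1 _]; rewrite xpair_eqE /= gtn_eqF.
- apply/funext => s; apply/funext => t; rewrite big_nat [RHS]big_nat.
  apply: eq_bigr => mu /andP[mu1 _]; rewrite big_nat [RHS]big_nat.
  by apply: eq_bigr => nu /andP[nu1 _]; rewrite xpair_eqE !gtn_eqF.
Qed.

Lemma main1_anova_of m a s t :
  anova_main1 (anova_of m a) s = combination m (block1 m) a s t.
Proof.
by rewrite /combination big_map; apply: eq_bigr => nu _; rewrite /tensor mulr1.
Qed.

Lemma main2_anova_of m a s t :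
  anova_main2 (anova_of m a) t = combination m (block2 m) a s t.
Proof.
by rewrite /combination big_map; apply: eq_bigr => nu _; rewrite /tensor mul1r.
Qed.

Lemma inter_anova_of m a s t :
  anova_inter (anova_of m a) s t = combination m (block12 m) a s t.
Proof.
rewrite /combination big_allpairs; apply: eq_bigr => mu _.
by apply: eq_bigr => nu _; rewrite /tensor mulrA.
Qed.

Lemma anova_eval_of m a s t :
  anova_eval (anova_of m a) s t = combination m (all_indices m) a s t.
Proof.
rewrite /anova_eval (main1_anova_of _ _ _ t) (main2_anova_of _ _ s).
rewrite inter_anova_of /combination /all_indices big_cons !big_cat /= -!addrA.
by rewrite /tensor /gamma eqxx !mulr1.
Qed.

Lemma grid_in01 m (k : 'I_m) : 0 <= (grid k : R) <= 1.
Proof.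
have m_gt0 : (0 < m)%N by exact: leq_ltn_trans (ltn_ord k).
by rewrite /grid divr_ge0//= ler_pdivrMr ?ltr0n// mul1r ler_nat.
Qed.

Lemma zero_main1 m a : ~~ odd m -> (0 < m)%N ->
  zero1 (anova_main1 (anova_of m a)) <-> {in block1 m, forall p, a p = 0}.
Proof.
move=> m_even m_gt0; split=> [h0|a0 t _]; last first.
  by rewrite (main1_anova_of _ _ _ 0) combination0.
apply: (combination_eq0 m_even); first by case: (blocks_uniq m).
  by move=> p /block1_sub; exact: all_indices_valid.
by move=> k l; rewrite -main1_anova_of h0// grid_in01.
Qed.

Lemma zero_main2 m a : ~~ odd m -> (0 < m)%N ->
  zero1 (anova_main2 (anova_of m a)) <-> {in block2 m, forall p, a p = 0}.
Proof.
move=> m_even m_gt0; split=> [h0|a0 t _]; last first.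
  by rewrite (main2_anova_of _ _ 0) combination0.
apply: (combination_eq0 m_even); first by case: (blocks_uniq m).
  by move=> p /block2_sub; exact: all_indices_valid.
by move=> k l; rewrite -main2_anova_of h0// grid_in01.
Qed.

Lemma zero_inter m a : ~~ odd m -> (0 < m)%N ->
  zero2 (anova_inter (anova_of m a)) <-> {in block12 m, forall p, a p = 0}.
Proof.
move=> m_even m_gt0; split=> [h0|a0 s t _ _]; last first.
  by rewrite inter_anova_of combination0.
apply: (combination_eq0 m_even); first by case: (blocks_uniq m).
  by move=> p /block12_sub; exact: all_indices_valid.
by move=> k l; rewrite -inter_anova_of h0// grid_in01.
Qed.

Definition weight2 m p : R := weight m p.1 * weight m p.2.

Lemma weight2_gt0 m p : valid m p -> 0 < weight2 m p.
Proof. by move=> /andP[/andP[? _] /andP[? _]]; rewrite mulr_gt0 ?weight_gt0. Qed.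

Lemma weight_1 m : weight m 1 = 1 :> R.
Proof. by rewrite /weight eqxx. Qed.

Lemma sum_weight2V m : (0 < m)%N ->
  [/\ \sum_(p <- block1 m) (weight2 m p)^-1 <= 1,
      \sum_(p <- block2 m) (weight2 m p)^-1 <= 1 &
      \sum_(p <- block12 m) (weight2 m p)^-1 <= 1].
Proof.
move=> m_gt0; have S_le := sum_weightV (R := R) m_gt0; split.
- rewrite big_map (eq_bigr (fun nu => (weight m nu)^-1))// => nu _.
  by rewrite /weight2 weight_1 mulr1.
- rewrite big_map (eq_bigr (fun nu => (weight m nu)^-1))// => nu _.
  by rewrite /weight2 weight_1 mul1r.
- rewrite big_allpairs.
  rewrite (eq_bigr (fun mu => (weight m mu)^-1
    * \sum_(2 <= nu < m.+1) (weight m nu)^-1)) => [|mu _]; last first.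
    by rewrite mulr_sumr; apply: eq_bigr => nu _; rewrite /weight2 invfM.
  rewrite -mulr_suml mulr_ile1// big_nat sumr_ge0// => nu /andP[nu1 _];
    by rewrite invr_ge0 ltW// weight_gt0// ltnW.
Qed.

Lemma cosso_objectiveE m (y : 'I_m -> 'I_m -> R) lambda th a : ~~ odd m -> (0 < m)%N ->
  let z := coefficient y in
  cosso_objective y lambda th (anova_of m a)
  = grid_mean2 (fun k l => y k l ^+ 2) - \sum_(p <- all_indices m) z p ^+ 2
    + (z (1%N, 1%N) - a (1%N, 1%N)) ^+ 2
    + component_objective (block1 m) (weight2 m) z lambda (theta1 th) a
    + component_objective (block2 m) (weight2 m) z lambda (theta2 th) a
    + component_objective (block12 m) (weight2 m) z lambda (theta12 th) a.
Proof.
move=> m_even m_gt0 z; rewrite /cosso_objective.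
rewrite -[X in X + _ + _ + _ + _]/(grid_mean2 (fun k l : 'I_m =>
  (y k l - anova_eval (anova_of m a) (grid k) (grid l)) ^+ 2)).
under eq_grid_mean2 do rewrite anova_eval_of.
rewrite residual_mean ?all_indices_uniq//; last exact: all_indices_valid.
rewrite /= !penalty1E// penalty2E// -/z.
have -> : \sum_(p <- all_indices m) (z p - a p) ^+ 2
    = (z (1%N, 1%N) - a (1%N, 1%N)) ^+ 2
      + (\sum_(p <- block1 m) (z p - a p) ^+ 2
      + (\sum_(p <- block2 m) (z p - a p) ^+ 2
      + \sum_(p <- block12 m) (z p - a p) ^+ 2)).
  by rewrite /all_indices big_cons !big_cat.
rewrite /component_objective.
have -> : \sum_(p <- block1 m) weight2 m p * a p ^+ 2
   = \sum_(2 <= nu < m.+1) weight m nu * a (nu, 1%N) ^+ 2.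
  by rewrite big_map; apply: eq_bigr => nu _; rewrite /weight2 weight_1 mulr1.
have -> : \sum_(p <- block2 m) weight2 m p * a p ^+ 2
   = \sum_(2 <= nu < m.+1) weight m nu * a (1%N, nu) ^+ 2.
  by rewrite big_map; apply: eq_bigr => nu _; rewrite /weight2 weight_1 mul1r.
have -> : \sum_(p <- block12 m) weight2 m p * a p ^+ 2
   = \sum_(2 <= mu < m.+1) \sum_(2 <= nu < m.+1)
     weight m mu * weight m nu * a (mu, nu) ^+ 2.
  by rewrite big_allpairs.
ring.
Qed.

(** The statistic that is compared with lambda to decide on a component. *)
Definition energy m r (y : 'I_m -> 'I_m -> R) : R :=
  \sum_(p <- r) coefficient y p ^+ 2 / weight2 m p.

Lemma component_objective_eq_in r w z lambda theta (a a' : nat * nat -> R) :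
  {in r, a =1 a'} ->
  component_objective r w z lambda theta a
  = component_objective r w z lambda theta a'.
Proof.
move=> aa'; rewrite /component_objective; congr (_ + _ * _ + _);
  by apply: eq_big_seq => p /aa' ->.
Qed.

(** Changing the coefficients of one block and its theta leaves the rest of the
    objective unchanged, so a global minimizer minimizes each component. *)
Lemma minimizer_selection m (y : 'I_m -> 'I_m -> R) lambda th g :
  ~~ odd m -> (0 < m)%N -> 0 < lambda -> cosso_minimizer y lambda th g ->
  [/\ zero1 (anova_main1 g) <-> energy (block1 m) y <= lambda,
      zero1 (anova_main2 g) <-> energy (block2 m) y <= lambda &
      zero2 (anova_inter g) <-> energy (block12 m) y <= lambda].
Proof.
move=> m_even m_gt0 lambda_gt0.
move=> [[[th1 th2 th12] /FspaceP[a ->] [z1 z2 z12]] opt].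
pose z := coefficient y.
have Z1 b := propext (zero_main1 b m_even m_gt0).
have Z2 b := propext (zero_main2 b m_even m_gt0).
have Z12 b := propext (zero_inter b m_even m_gt0).
move: z1 z2 z12; rewrite Z1 Z2 Z12 => z1 z2 z12.
have {}opt t1 t2 t12 b : 0 <= t1 -> 0 <= t2 -> 0 <= t12 ->
    (t1 = 0 -> {in block1 m, forall p, b p = 0}) ->
    (t2 = 0 -> {in block2 m, forall p, b p = 0}) ->
    (t12 = 0 -> {in block12 m, forall p, b p = 0}) ->
    b (1%N, 1%N) = a (1%N, 1%N) ->
    component_objective (block1 m) (weight2 m) z lambda (theta1 th) a
    + component_objective (block2 m) (weight2 m) z lambda (theta2 th) a
    + component_objective (block12 m) (weight2 m) z lambda (theta12 th) a
    <= component_objective (block1 m) (weight2 m) z lambda t1 b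
    + component_objective (block2 m) (weight2 m) z lambda t2 b
    + component_objective (block12 m) (weight2 m) z lambda t12 b.
  move=> t1_ge0 t2_ge0 t12_ge0 b1 b2 b12 b11.
  have := opt (Thetas t1 t2 t12) (anova_of m b).
  rewrite !cosso_objectiveE//= b11 -!addrA !lerD2l -/z !addrA; apply.
  split=> //; first exact: Fspace_anova_of.
  by rewrite Z1 Z2 Z12.
have w_gt0 r : {subset r <= all_indices m} -> {in r, forall p, 0 < weight2 m p}.
  by move=> rs p /rs pi; rewrite weight2_gt0// all_indices_valid.
pose splice r (a' : nat * nat -> R) p := if p \in r then a' p else a p.
have spliceE r a' : {in r, splice r a' =1 a'} by move=> p pr; rewrite /splice pr.
have splice_out r r' a' : {in r', forall p, p \notin r} -> {in r', splice r a' =1 a}.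
  by move=> rr' p /rr' pNr; rewrite /splice (negbTE pNr).
have n12 : {in block2 m, forall p, p \notin block1 m}.
  by move=> p; rewrite mem_block1 mem_block2 => /andP[/eqP -> _].
have n13 : {in block12 m, forall p, p \notin block1 m}.
  move=> p; rewrite mem_block1 mem_block12 => /andP[_ /andP[p2 _]].
  by rewrite [p.2 == _]gtn_eqF// andbF.
have n23 : {in block12 m, forall p, p \notin block2 m}.
  move=> p; rewrite mem_block2 mem_block12 => /andP[/andP[p1 _] _].
  by rewrite gtn_eqF.
have n21 : {in block1 m, forall p, p \notin block2 m}.
  by move=> p pr; apply: contraL pr => /n12.
have n31 : {in block1 m, forall p, p \notin block12 m}.
  by move=> p pr; apply: contraL pr => /n13.
have n32 : {in block2 m, forall p, p \notin block12 m}.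
  by move=> p pr; apply: contraL pr => /n23.
have splice0 r r' (t : R) a' : {in r', forall p, p \notin r} ->
    (t = 0 -> {in r', forall p, a p = 0}) ->
    t = 0 -> {in r', forall p, splice r a' p = 0}.
  by move=> rr' a0 t0 p pr; rewrite (splice_out r r')// a0.
have spliceE0 r (t : R) a' : (t = 0 -> {in r, forall p, a' p = 0}) ->
    t = 0 -> {in r, forall p, splice r a' p = 0}.
  by move=> a0 t0 p pr; rewrite spliceE// a0.
split.
- apply: (component_threshold (w_gt0 _ (@block1_sub m)) _ th1) => // t a' t_ge0 a'0.
  have := opt t (theta2 th) (theta12 th) (splice (block1 m) a') t_ge0 th2 th12
    (spliceE0 _ _ _ a'0) (splice0 _ _ _ _ n12 z2) (splice0 _ _ _ _ n13 z12).
  rewrite {1}/splice mem_block1 => /(_ erefl).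
  rewrite (component_objective_eq_in _ _ _ _ (spliceE (block1 m) a')).
  rewrite (component_objective_eq_in _ _ _ _ (splice_out _ _ a' n12)).
  rewrite (component_objective_eq_in _ _ _ _ (splice_out _ _ a' n13)).
  by rewrite !lerD2r.
- apply: (component_threshold (w_gt0 _ (@block2_sub m)) _ th2) => // t a' t_ge0 a'0.
  have := opt (theta1 th) t (theta12 th) (splice (block2 m) a') th1 t_ge0 th12
    (splice0 _ _ _ _ n21 z1) (spliceE0 _ _ _ a'0) (splice0 _ _ _ _ n23 z12).
  rewrite {1}/splice mem_block2 => /(_ erefl).
  rewrite (component_objective_eq_in _ _ _ _ (spliceE (block2 m) a')).
  rewrite (component_objective_eq_in _ _ _ _ (splice_out _ _ a' n21)).
  rewrite (component_objective_eq_in _ _ _ _ (splice_out _ _ a' n23)).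
  by rewrite lerD2r lerD2l.
- apply: (component_threshold (w_gt0 _ (@block12_sub m)) _ th12) => // t a' t_ge0 a'0.
  have := opt (theta1 th) (theta2 th) t (splice (block12 m) a') th1 th2 t_ge0
    (splice0 _ _ _ _ n31 z1) (splice0 _ _ _ _ n32 z2) (spliceE0 _ _ _ a'0).
  rewrite {1}/splice mem_block12 => /(_ erefl).
  rewrite (component_objective_eq_in _ _ _ _ (spliceE (block12 m) a')).
  rewrite (component_objective_eq_in _ _ _ _ (splice_out _ _ a' n31)).
  rewrite (component_objective_eq_in _ _ _ _ (splice_out _ _ a' n32)).
  by rewrite lerD2l.
Qed.

End coefficients.

(** * Probability of a wrong selection *)

Section extension.
Context {R : realType}.
Implicit Types (m nu : nat).

(** The factor from coefficients in the basis for [m0] to those in the basis for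
    a larger size: gamma_m0 acquires a factor sqrt 2 once it is no longer the
    last function. *)
Definition refinement m0 nu : R :=
  if (nu < m0)%N then 1 else if nu == m0 then (Num.sqrt 2)^-1 else 0.

Lemma gamma_refinement m0 m nu (t : R) : ~~ odd m0 -> (1 < m0)%N ->
  (m0 < m)%N -> (nu <= m0)%N ->
  gamma m0 nu t = refinement m0 nu * gamma m nu t.
Proof.
move=> m0_even m0_gt1 m0m; rewrite /refinement leq_eqVlt => /predU1P[->|nu_lt].
  rewrite ltnn eqxx /gamma (gtn_eqF m0_gt1) (ltn_eqF m0m) eqxx (negbTE m0_even).
  rewrite mulKf ?gt_eqF ?sqrtr_gt0//; congr cos; congr (_ * _).
  rewrite -[in LHS](odd_double_half m0) (negbTE m0_even) add0n -mul2n natrM; ring.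
by rewrite nu_lt mul1r /gamma (ltn_eqF nu_lt) (ltn_eqF (ltn_trans nu_lt m0m)).
Qed.

Lemma gamma_sum_refinement m0 m (c : nat -> R) t : ~~ odd m0 -> (1 < m0)%N ->
  (m0 < m)%N ->
  \sum_(2 <= nu < m0.+1) c nu * gamma m0 nu t
  = \sum_(2 <= nu < m.+1) (c nu * refinement m0 nu) * gamma m nu t.
Proof.
move=> m0_even m0_gt1 m0m.
rewrite [RHS](big_cat_nat (leqW m0_gt1) (leqW m0m)) /=.
rewrite [X in _ + X]big_nat [X in _ + X]big1 ?addr0 => [|nu /andP[nu_gt _]].
  rewrite big_nat [RHS]big_nat; apply: eq_bigr => nu /andP[_ nu_le].
  by rewrite (gamma_refinement _ m0_even m0_gt1 m0m)// mulrA.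
by rewrite /refinement ltnNge ltnW// gtn_eqF// mulr0 mul0r.
Qed.

(** The coefficients of a fixed trigonometric polynomial do not depend on the
    size of the grid once it is large enough. *)
Lemma anova_of_refinement m0 (a0 : nat * nat -> R) :
  ~~ odd m0 -> (1 < m0)%N ->
  exists a, forall m, (m0 < m)%N -> anova_of m0 a0 = anova_of m a.
Proof.
move=> m0_even m0_gt1.
exists (fun p => a0 p * refinement m0 p.1 * refinement m0 p.2) => m m0m.
have r1 : refinement m0 1 = 1 by rewrite /refinement m0_gt1.
rewrite /anova_of /= r1; congr Anova.
- by rewrite !mulr1.
- apply/funext => t; rewrite (gamma_sum_refinement _ _ m0_even m0_gt1 m0m).
  by apply: eq_bigr => nu _; rewrite mulr1.
- apply/funext => t; rewrite (gamma_sum_refinement _ _ m0_even m0_gt1 m0m).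
  by apply: eq_bigr => nu _; rewrite mulr1.
- apply/funext => s; apply/funext => t.
  transitivity (\sum_(2 <= mu < m0.+1) (\sum_(2 <= nu < m.+1)
      (a0 (mu, nu) * refinement m0 nu) * gamma m nu t) * gamma m0 mu s).
    apply: eq_bigr => mu _.
    rewrite -(gamma_sum_refinement _ _ m0_even m0_gt1 m0m) mulr_suml.
    by apply: eq_bigr => nu _; ring.
  rewrite (gamma_sum_refinement _ _ m0_even m0_gt1 m0m).
  apply: eq_bigr => mu _; rewrite !mulr_suml.
  by apply: eq_bigr => nu _; ring.
Qed.

End extension.

Section selection_error.
Context d (T : measurableType d) (R : realType) (P : probability T R).
Context (sigma : R) (sigma_neq0 : sigma != 0).
Context (m : nat) (m_even : ~~ odd m) (m_gt0 : (0 < m)%N).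
Context (eps : 'I_m -> 'I_m -> {RV P >-> R}).
Context (eps_indep :
  mutually_independent (fun kl : 'I_m * 'I_m => eps kl.1 kl.2)).
Context (eps_normal : forall k l, centered_normal sigma (eps k l)).

Local Notation V := (noise_variance sigma).

Lemma noise_variance_ge0 : 0 <= V.
Proof. by rewrite fine_ge0// integral_ge0// => x _; rewrite lee_fin sqr_ge0. Qed.

Lemma markov_inequality (U : T -> R) (M c : R) : measurable_fun setT U ->
  (forall w, 0 <= U w) -> (\int[P]_w (U w)%:E <= M%:E)%E -> 0 < c ->
  (P [set w | (c <= U w)%R] <= (M / c)%:E)%E.
Proof.
move=> mU U_ge0 UM c_gt0.
rewrite EFinM muleC lee_pdivlMl//.
apply: le_trans UM.
have := @le_integral_comp_abse _ _ _ P _ measurableT (EFin \o U) c id.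
rewrite setTI => /(_ (@measurable_id _ _ _) (fun r h => h)).
have mEU : measurable_fun setT (EFin \o U) by apply/measurable_EFinP.
move=> /(_ (fun x y _ _ xy => xy) mEU c_gt0) H.
apply: (le_trans _ (le_trans H _)).
  rewrite le_eqVlt; apply/orP; left; apply/eqP; congr (_ * P _)%E.
  by apply: eq_set => w /=; rewrite lee_fin ger0_norm.
rewrite le_eqVlt; apply/orP; left; apply/eqP.
by apply: eq_integral => w _ /=; rewrite ger0_norm.
Qed.

Definition noise w : 'I_m -> 'I_m -> R := fun k l => eps k l w.

Lemma measurable_coefficient p :
  measurable_fun setT (fun w => coefficient (noise w) p).
Proof.
apply: measurable_funM => //; apply: measurable_sum => k.
by apply: measurable_sum => l; apply: measurable_funM.
Qed.

Lemma noise_coefficient_second_moment p : valid m p ->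
  (\int[P]_w (coefficient (noise w) p ^+ 2)%:E = (V / (m ^ 2)%:R)%:E)%E.
Proof.
move=> pv.
pose x (kl : 'I_m * 'I_m) : R :=
  (m ^ 2)%:R^-1 * tensor m p (grid kl.1) (grid kl.2).
have cE w : coefficient (noise w) p = \sum_kl x kl * eps kl.1 kl.2 w.
  rewrite /coefficient /grid_mean2 pair_big mulr_sumr /=.
  by apply: eq_bigr => kl _; rewrite /x /noise; ring.
under eq_integral do rewrite cE.
rewrite (@white_noise_second_moment _ _ _ _ sigma sigma_neq0 _
  (fun kl => eps kl.1 kl.2))//.
congr (_ * _)%:E.
transitivity ((m ^ 2)%:R^-1 * grid_mean2 (fun k l : 'I_m =>
    tensor m p (grid k) (grid l) * tensor m p (grid k) (grid l)) : R).
  rewrite /grid_mean2 pair_big !mulr_sumr /=.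
  by apply: eq_bigr => kl _; rewrite /x; ring.
by rewrite tensor_orthonormal// eqxx mulr1.
Qed.

Context (y : 'I_m -> 'I_m -> R) (r : seq (nat * nat)).
Context (r_valid : {in r, forall p, valid m p}).

Definition data w : 'I_m -> 'I_m -> R := fun k l => y k l + eps k l w.

Lemma coefficient_data w p :
  coefficient (data w) p = coefficient y p + coefficient (noise w) p.
Proof. exact: coefficientD. Qed.

Lemma measurable_energy : measurable_fun setT (fun w => energy r (data w)).
Proof.
apply: measurable_sum => p; apply: measurable_funM => //.
apply: measurable_funX.
rewrite (_ : (fun w => _) = fun w => coefficient y p + coefficient (noise w) p).
  by apply: measurable_funD => //; exact: measurable_coefficient.
by apply/funext => w; exact: coefficient_data.
Qed.

Lemma measurable_selected (lambda : R) (Z : Prop) :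
  measurable [set w | energy r (data w) <= lambda <-> Z].
Proof.
have mA : measurable [set w | energy r (data w) <= lambda].
  rewrite -[X in measurable X]setTI.
  by apply: measurable_fun_le => //; exact: measurable_energy.
have [z|nz] := pselect Z.
  rewrite (_ : [set w | _] = [set w | energy r (data w) <= lambda])//.
  by apply/seteqP; split => w /=; tauto.
rewrite (_ : [set w | _] = ~` [set w | energy r (data w) <= lambda]).
  exact: measurableC.
by apply/seteqP; split => w /=; tauto.
Qed.

(** Markov's inequality for the energy, whose expectation is at most V / n. *)
Lemma spurious_selection (lambda : R) : 0 < lambda ->
  {in r, forall p, coefficient y p = 0} ->
  \sum_(p <- r) (weight2 m p)^-1 <= 1 :> R ->
  (P [set w | ~ (energy r (data w) <= lambda)%R]
   <= (V / ((m ^ 2)%:R * lambda))%:E)%E.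
Proof.
move=> lambda_gt0 y0 r_sum.
have energyE w : energy r (data w)
    = \sum_(p <- r) (weight2 m p)^-1 * coefficient (noise w) p ^+ 2.
  rewrite /energy; apply: eq_big_seq => p pr.
  by rewrite coefficient_data y0// add0r mulrC.
have w2 p : p \in r -> 0 <= (weight2 m p)^-1 :> R.
  by move=> pr; rewrite invr_ge0 ltW// weight2_gt0// r_valid.
have n_gt0 : 0 < (m ^ 2)%:R :> R by rewrite ltr0n expn_gt0 m_gt0.
apply: (@le_trans _ _ (P [set w | lambda <= energy r (data w)])).
  apply: le_measure; rewrite ?inE.
  - rewrite (_ : [set w | _] = [set w | energy r (data w) <= lambda <-> False]).
      exact: measurable_selected.
    by apply/seteqP; split => w /=; tauto.
  - rewrite -[X in measurable X]setTI.
    by apply: measurable_fun_le => //; exact: measurable_energy.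
  - by move=> w /= /negP; rewrite -ltNge => /ltW.
rewrite invfM mulrA; apply: markov_inequality => //.
- exact: measurable_energy.
- move=> w; rewrite energyE big_seq sumr_ge0// => p /w2 pw.
  by rewrite mulr_ge0// sqr_ge0.
- have -> : (\int[P]_w (energy r (data w))%:E
      = \sum_(p <- r) ((weight2 m p)^-1 * (V / (m ^ 2)%:R))%:E)%E.
    transitivity (\int[P]_w (\sum_(p <- r)
       if p \in r then ((weight2 m p)^-1 * coefficient (noise w) p ^+ 2)%:E else 0))%E.
      apply: eq_integral => w _; rewrite energyE -sumEFin.
      by apply: eq_big_seq => p ->.
    rewrite ge0_integral_sum//.
    + apply: eq_big_seq => p pr; rewrite pr.
      under eq_integral do rewrite EFinM.
      rewrite ge0_integralZl//.
      * by rewrite noise_coefficient_second_moment// r_valid.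
      * apply/measurable_EFinP; apply: measurable_funX.
        exact: measurable_coefficient.
      * by move=> w _; rewrite lee_fin sqr_ge0.
      * by rewrite lee_fin w2.
    + move=> p; case: (p \in r) => //.
      apply/measurable_EFinP; apply: measurable_funM => //.
      by apply: measurable_funX; exact: measurable_coefficient.
    + move=> p w _; case: ifP => // pr.
      by rewrite lee_fin mulr_ge0 ?w2// sqr_ge0.
  rewrite sumEFin lee_fin -mulr_suml ler_piMl//.
  by rewrite divr_ge0// ?noise_variance_ge0 ?ltW.
Qed.

(** A small energy makes the empirical coefficient at most |c| / 2 in absolute
    value, hence the noise coefficient at least |c| / 2. *)
Lemma missed_selection (lambda : R) (p : nat * nat) : p \in r ->
  coefficient y p != 0 ->
  lambda * weight2 m p <= coefficient y p ^+ 2 / 4 ->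
  (P [set w | (energy r (data w) <= lambda)%R]
   <= (4 * V / ((m ^ 2)%:R * coefficient y p ^+ 2))%:E)%E.
Proof.
move=> pr yp0 lambda_le; set c := coefficient y p in yp0 lambda_le *.
have c2_gt0 : 0 < c ^+ 2 by rewrite exprn_even_gt0.
have n_gt0 : 0 < (m ^ 2)%:R :> R by rewrite ltr0n expn_gt0 m_gt0.
have me2 : measurable_fun setT (fun w => coefficient (noise w) p ^+ 2).
  by apply: measurable_funX; exact: measurable_coefficient.
apply: (@le_trans _ _ (P [set w | c ^+ 2 / 4 <= coefficient (noise w) p ^+ 2])).
  apply: le_measure; rewrite ?inE.
  - rewrite (_ : [set w | _] = [set w | energy r (data w) <= lambda <-> True]).
      exact: measurable_selected.
    by apply/seteqP; split => w /=; tauto.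
  - by rewrite -[X in measurable X]setTI; apply: measurable_fun_le.
  - move=> w /= energy_le.
    have : (c + coefficient (noise w) p) ^+ 2 / weight2 m p <= lambda.
      apply: le_trans energy_le; rewrite /energy (big_rem p)//=.
      rewrite coefficient_data lerDl big_seq sumr_ge0// => q /mem_rem qr.
      by rewrite divr_ge0 ?sqr_ge0// ltW// weight2_gt0// r_valid.
    rewrite ler_pdivrMr ?weight2_gt0 ?r_valid// => /le_trans /(_ lambda_le).
    set e := coefficient (noise w) p => ce_le.
    have four : 2 ^+ 2 = 4 :> R by ring.
    have : `|c + e| <= `|c| / 2.
      rewrite -(ler_pXn2r (n := 2))// ?nnegrE ?divr_ge0//.
      rewrite real_normK ?num_real// expr_div_n real_normK ?num_real//.
      by rewrite four.
    have : `|c| <= `|c + e| + `|e|.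
      by rewrite -{1}(addrK e c) (le_trans (ler_normB _ _)).
    move=> h1 h2; have h3 : `|c| / 2 <= `|e| by lra.
    have : (`|c| / 2) ^+ 2 <= `|e| ^+ 2 by rewrite ler_pXn2r ?nnegrE ?divr_ge0.
    by rewrite expr_div_n !real_normK ?num_real// four.
apply: (le_trans (@markov_inequality _ (V / (m ^ 2)%:R) (c ^+ 2 / 4) me2 _ _ _)).
- by move=> w; exact: sqr_ge0.
- by rewrite noise_coefficient_second_moment// r_valid.
- by rewrite divr_gt0.
rewrite lee_fin le_eqVlt; apply/orP; left; apply/eqP.
by field; rewrite yp0 pnatr_eq0 -lt0n m_gt0.
Qed.

End selection_error.

(** * Consistency *)

(** A single bound C / (n lambda) for both kinds of error. The constants must not
    depend on [m]: a coefficient that witnesses that the component is not zero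
    is chosen once, in the block of the fixed size [m1]. *)
Lemma block_selection_error (R : realType) (sigma : R)
  (block : nat -> seq (nat * nat)) (a : nat * nat -> R) (Z : Prop) (m0 : nat) :
  sigma != 0 ->
  (forall m, {subset block m <= all_indices m}) ->
  (forall m, (0 < m)%N -> \sum_(p <- block m) (weight2 m p)^-1 <= 1 :> R) ->
  (forall m m', (m <= m')%N -> {subset block m <= block m'}) ->
  (forall m, ~~ odd m -> (m0 < m)%N -> Z <-> {in block m, forall p, a p = 0}) ->
  exists C delta : R, exists m1 : nat, 0 < delta /\
  forall m, ~~ odd m -> (m1 < m)%N ->
  forall d (T : measurableType d) (P : probability T R)
    (eps : 'I_m -> 'I_m -> {RV P >-> R}) (lambda : R),
  mutually_independent (fun kl : 'I_m * 'I_m => eps kl.1 kl.2) ->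
  (forall k l, centered_normal sigma (eps k l)) ->
  0 < lambda -> lambda <= delta ->
  (P [set w | ~ ((energy (block m)
       (data eps (fun k l => anova_eval (anova_of m a) (grid k) (grid l)) w)
       <= lambda)%R <-> Z)]
   <= (C / ((m ^ 2)%:R * lambda))%:E)%E.
Proof.
move=> sigma0 block_sub block_sum block_mono ZP.
have coefE m p : ~~ odd m -> (0 < m)%N -> p \in all_indices m ->
    coefficient (fun k l : 'I_m =>
      anova_eval (anova_of m a) (grid k) (grid l)) p = a p.
  move=> m_even m_gt0 pm; rewrite /coefficient.
  under eq_grid_mean2 do rewrite anova_eval_of.
  rewrite [LHS]coefficient_combination ?pm ?all_indices_uniq//.
    exact: all_indices_valid.
  exact: (all_indices_valid m_gt0 pm).
have block_valid m : (0 < m)%N -> {in block m, forall p, valid m p}.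
  by move=> m_gt0 p /block_sub; exact: all_indices_valid.
have [z|nz] := pselect Z.
  exists (noise_variance sigma), 1, m0; split=> // m m_even m0m d T P eps lambda.
  move=> indep normal lambda_gt0 _; have m_gt0 := leq_ltn_trans (leq0n _) m0m.
  rewrite (_ : [set w | _] = [set w | ~ (energy (block m) (data eps (fun k l =>
     anova_eval (anova_of m a) (grid k) (grid l)) w) <= lambda)%R]); last first.
    by apply/seteqP; split => w /=; tauto.
  apply: spurious_selection => //; first exact: block_valid.
    move=> p pm; rewrite coefE// ?block_sub//.
    by have /(_ z) := (ZP m m_even m0m).1; apply.
  exact: block_sum.
pose m1 := m0.+1.*2.
have m01 : (m0 < m1)%N by rewrite /m1 -addnn ltn_addr.
have m1_even : ~~ odd m1 by rewrite odd_double.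
have [p pm1 ap0] : exists2 p, p \in block m1 & a p != 0.
  apply: contrapT => H; apply: nz; apply/(ZP m1 m1_even m01) => p pm1.
  by apply/eqP/negPn/negP => ap0; apply: H; exists p.
pose W : R := (1 + frequency p.1 ^+ 4) * (1 + frequency p.2 ^+ 4).
have f4 nu : 0 < 1 + frequency nu ^+ 4 :> R by rewrite ltr_pwDl ?exprn_even_ge0.
have W_gt0 : 0 < W by rewrite mulr_gt0.
have a2_gt0 : 0 < a p ^+ 2 by rewrite exprn_even_gt0.
exists (4 * noise_variance sigma / a p ^+ 2).
exists (Num.min 1 (a p ^+ 2 / 4 / W)), m1; split.
  by rewrite lt_min ltr01 divr_gt0// divr_gt0.
move=> m m_even m1m d T P eps lambda indep normal lambda_gt0.
rewrite le_min => /andP[lambda_le1 lambda_le].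
have m_gt0 := leq_ltn_trans (leq0n _) m1m.
have pm : p \in block m by apply: (block_mono _ _ (ltnW m1m)).
have n_gt0 : 0 < (m ^ 2)%:R :> R by rewrite ltr0n expn_gt0 m_gt0.
rewrite (_ : [set w | _] = [set w | (energy (block m) (data eps (fun k l =>
   anova_eval (anova_of m a) (grid k) (grid l)) w) <= lambda)%R]); last first.
  apply/seteqP; split => w /=; last by tauto.
  by move=> H; apply: contrapT => nE; apply: H; split.
have := @missed_selection _ _ _ P sigma sigma0 m m_even m_gt0 eps indep normal
  (fun k l => anova_eval (anova_of m a) (grid k) (grid l)) (block m)
  (block_valid m m_gt0) lambda p pm.
rewrite coefE ?block_sub// => /(_ ap0) H; apply: (le_trans (H _)).
  have w2 : weight2 m p <= W.
    have /andP[/andP[p1 _] /andP[p2 _]] := block_valid m m_gt0 p pm.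
    by rewrite ler_pM ?weight_le// ltW// weight_gt0.
  apply: (@le_trans _ _ (lambda * W)); first by rewrite ler_pM2l.
  by rewrite -ler_pdivlMr.
rewrite lee_fin.
have -> : 4 * noise_variance sigma / ((m ^ 2)%:R * a p ^+ 2)
    = 4 * noise_variance sigma / a p ^+ 2 * (m ^ 2)%:R^-1 :> R.
  by rewrite invfM; ring.
rewrite ler_wpM2l//.
  apply: divr_ge0; last exact: sqr_ge0.
  by apply: mulr_ge0 => //; exact: noise_variance_ge0.
by rewrite lef_pV2 ?posrE ?mulr_gt0// ler_piMr// ltW.
Qed.

Theorem mainTheorem5 (R : realType)
  (d : nat -> measure_display) (T : forall m : nat, measurableType (d m))
  (P : forall m : nat, probability (T m) R)
  (f : anova R) (sigma : R) (lambda : nat -> R)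
  (eps : forall m : nat, 'I_m -> 'I_m -> {RV (P m) >-> R})
  (theta_hat : forall m : nat, T m -> thetas R)
  (f_hat : forall m : nat, T m -> anova R) :
  (\forall q \near \oo, Fspace q.*2 f) ->
  0 < sigma ->
  (forall m : nat, (0 < m)%N -> ~~ odd m ->
     mutually_independent (fun kl : 'I_m * 'I_m => eps m kl.1 kl.2)) ->
  (forall m : nat, (0 < m)%N -> ~~ odd m ->
     forall k l : 'I_m, centered_normal sigma (eps m k l)) ->
  (forall m : nat, (0 < m)%N -> ~~ odd m -> 0 < lambda (m ^ 2)%N) ->
  (forall m : nat, (0 < m)%N -> ~~ odd m -> forall w : T m,
     cosso_minimizer
       (fun k l : 'I_m => anova_eval f (grid k) (grid l) + eps m k l w)
       (lambda (m ^ 2)%N) (theta_hat m w) (f_hat m w)) ->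
  (lambda (q.*2 ^ 2)%N @[q --> \oo] --> (0 : R)) ->
  (((q.*2 ^ 2)%:R * lambda (q.*2 ^ 2)%N : R) @[q --> \oo] --> +oo) ->
  (forall m : nat, (0 < m)%N -> ~~ odd m ->
     measurable [set w : T m | same_model (f_hat m w) f]) /\
  (P q.*2 [set w : T q.*2 | same_model (f_hat q.*2 w) f] @[q --> \oo]
     --> (1 : \bar R)%E).
Proof.
move=> f_in sigma_gt0 indep normal lambda_gt0 minim lambda0 nlambda.
have sigma0 : sigma != 0 by rewrite gt_eqF.
pose y m (k l : 'I_m) : R := anova_eval f (grid k) (grid l).
pose A m r Z := [set w : T m |
  energy r (data (eps m) (y m) w) <= lambda (m ^ 2)%N <-> Z].
have mA m r Z : measurable (A m r Z) by exact: measurable_selected.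
have sameE m : (0 < m)%N -> ~~ odd m ->
    [set w : T m | same_model (f_hat m w) f]
    = A m (block1 m) (zero1 (anova_main1 f))
      `&` A m (block2 m) (zero1 (anova_main2 f))
      `&` A m (block12 m) (zero2 (anova_inter f)).
  move=> m_gt0 m_even; apply/seteqP; split => w;
    have [/propext E1 /propext E2 /propext E12] := minimizer_selection m_even
      m_gt0 (lambda_gt0 m m_gt0 m_even) (minim m m_gt0 m_even w);
    rewrite /= /same_model E1 E2 E12.
  - by case=> s1 s2 s12; split; first split.
  - by case=> [[s1 s2] s12]; split.
have m_same m : (0 < m)%N -> ~~ odd m ->
    measurable [set w : T m | same_model (f_hat m w) f].
  move=> m_gt0 m_even; rewrite sameE//.
  by apply: measurableI; first apply: measurableI; exact: mA.
split=> //.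
have [m0 [m0_even m0_gt1 /FspaceP[a0 fE0]]] :
    exists m0, [/\ ~~ odd m0, (1 < m0)%N & Fspace m0 f].
  have [q0 _ f_q0] := f_in; exists (q0.+1.*2); split.
  - by rewrite odd_double.
  - by rewrite doubleS.
  - by apply: f_q0 => /=; exact: leqnSn.
have [a aE] := anova_of_refinement a0 m0_even m0_gt1.
have {aE fE0} fE m : (m0 < m)%N -> f = anova_of m a by rewrite fE0; exact: aE.
have m_pos m : (m0 < m)%N -> (0 < m)%N by exact: leq_ltn_trans.
have sums m : (0 < m)%N -> _ := fun m_gt0 => sum_weight2V (R := R) m_gt0.
have error block Z :
    (forall m, {subset block m <= all_indices m}) ->
    (forall m, (0 < m)%N -> \sum_(p <- block m) (weight2 m p)^-1 <= 1 :> R) ->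
    (forall m m', (m <= m')%N -> {subset block m <= block m'}) ->
    (forall m, ~~ odd m -> (m0 < m)%N ->
       Z <-> {in block m, forall p, a p = 0}) ->
    exists C delta : R, exists m1 : nat, 0 < delta /\
      forall m, ~~ odd m -> (m1 < m)%N -> (m0 < m)%N ->
      lambda (m ^ 2)%N <= delta ->
      (P m (~` A m (block m) Z) <= (C / ((m ^ 2)%:R * lambda (m ^ 2)%N))%:E)%E.
  move=> block_sub block_sum block_mono ZP.
  have [C [delta [M [delta_gt0 err]]]] :=
    block_selection_error sigma0 block_sub block_sum block_mono ZP.
  exists C, delta, M; split=> // m m_even Mm m0m ldelta.
  have := err m m_even Mm _ _ (P m) (eps m) (lambda (m ^ 2)%N)
    (indep m (m_pos m m0m) m_even) (normal m (m_pos m m0m) m_even)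
    (lambda_gt0 m (m_pos m m0m) m_even) ldelta.
  by rewrite -(fE m m0m).
have [|||C1 [del1 [M1 [del1_gt0 err1]]]] :=
  error block1 (zero1 (anova_main1 f)) block1_sub.
- by move=> m /sums[].
- move=> m m' mm' p; rewrite !mem_block1 => /andP[/andP[-> /= pm] ->].
  by rewrite (leq_trans pm mm').
- move=> m m_even m0m; have := zero_main1 a m_even (m_pos m m0m).
  by rewrite -(fE m m0m).
have [|||C2 [del2 [M2 [del2_gt0 err2]]]] :=
  error block2 (zero1 (anova_main2 f)) block2_sub.
- by move=> m /sums[].
- move=> m m' mm' p; rewrite !mem_block2 => /andP[-> /andP[-> /= pm]].
  by rewrite (leq_trans pm mm').
- move=> m m_even m0m; have := zero_main2 a m_even (m_pos m m0m).
  by rewrite -(fE m m0m).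
have [|||C12 [del12 [M12 [del12_gt0 err12]]]] :=
  error block12 (zero2 (anova_inter f)) block12_sub.
- by move=> m /sums[].
- move=> m m' mm' p; rewrite !mem_block12.
  move=> /andP[/andP[-> /= pm] /andP[-> /= pm']].
  by rewrite (leq_trans pm mm') (leq_trans pm' mm').
- move=> m m_even m0m; have := zero_inter a m_even (m_pos m m0m).
  by rewrite -(fE m m0m).
pose C := C1 + C2 + C12.
pose b q : R := C / ((q.*2 ^ 2)%:R * lambda (q.*2 ^ 2)%N).
have ldel delta : 0 < delta -> \forall q \near \oo, lambda (q.*2 ^ 2)%N <= delta.
  by move=> delta_gt0; move/cvgr_le : lambda0; apply.
apply: (@squeeze_cvge _ _ _ R (fun q => (1 - b q)%:E) _ (fun=> 1%E)).
- near=> q.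
  have q_gt : (m0 + M1 + M2 + M12 < q.*2)%N.
    have : (m0 + M1 + M2 + M12 < q)%N by near: q; exact: nbhs_infty_gt.
    by move=> /leq_trans; apply; rewrite -addnn leq_addr.
  have m0q : (m0 < q.*2)%N by apply: leq_ltn_trans q_gt; rewrite -!addnA leq_addr.
  have M1q : (M1 < q.*2)%N.
    by apply: leq_ltn_trans q_gt; rewrite -!addnA addnCA leq_addr.
  have M2q : (M2 < q.*2)%N.
    by apply: leq_ltn_trans q_gt; rewrite -addnA addnCA leq_addr.
  have M12q : (M12 < q.*2)%N by apply: leq_ltn_trans q_gt; rewrite leq_addl.
  have q_even : ~~ odd q.*2 by rewrite odd_double.
  have q_pos := m_pos _ m0q.
  have l1 : lambda (q.*2 ^ 2)%N <= del1 by near: q; exact: ldel.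
  have l2 : lambda (q.*2 ^ 2)%N <= del2 by near: q; exact: ldel.
  have l12 : lambda (q.*2 ^ 2)%N <= del12 by near: q; exact: ldel.
  apply/andP; split; last by apply: probability_le1; exact: m_same.
  set S := [set w | _]; have mS : measurable S by exact: m_same.
  have : (P q.*2 (~` S) <= (b q)%:E)%E.
    rewrite /S sameE// (setCI (A _ _ _ `&` A _ _ _) (A _ _ _)).
    rewrite (setCI (A _ (block1 _) _) (A _ _ _)).
    have mAC r Z : measurable (~` A q.*2 r Z) by exact: measurableC.
    apply: (le_trans (measureU2 _ (measurableU _ _ (mAC _ _) (mAC _ _)) (mAC _ _))).
    have -> : b q = C1 / ((q.*2 ^ 2)%:R * lambda (q.*2 ^ 2)%N)
       + C2 / ((q.*2 ^ 2)%:R * lambda (q.*2 ^ 2)%N)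
       + C12 / ((q.*2 ^ 2)%:R * lambda (q.*2 ^ 2)%N) by rewrite /b /C !mulrDl.
    rewrite 2!EFinD; apply: leeD; last exact: err12.
    apply: (le_trans (measureU2 _ (mAC _ _) (mAC _ _))).
    by apply: leeD; [exact: err1|exact: err2].
  rewrite probability_setC// => PS.
  rewrite EFinB leeBlDr// addeC -leeBlDr//.
  by rewrite fin_num_measure.
- apply: cvg_EFin; first by near=> q.
  rewrite -[X in _ --> X](subr0 1); apply: cvgB; first exact: cvg_cst.
  rewrite -(mulr0 C); apply: cvgM; first exact: cvg_cst.
  apply/gtr0_cvgV0 => //; near=> q.
  have q_gt0 : (0 < q)%N by near: q; exact: nbhs_infty_gt.
  by rewrite mulr_gt0 ?ltr0n ?expn_gt0 ?double_gt0 ?q_gt0// lambda_gt0//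
    ?double_gt0 ?odd_double.
- exact: cvg_cst.
Unshelve. all: by end_near. Qed.
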